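(* If $a\in[0,\tfrac13)$, then the set $\mathcal B=\{\gamma_k\}_{k\in\mathbb Z}$ is a Hilbert basis (i.e. a complete orthonormal system) of the space $L^2(S^1,\mathbb C)$ equipped with the inner product $$ \langle\!\langle f,g\rangle\!\rangle=\frac1{2\pi}\int_0^{2\pi}\mathcal R(f)(t)\,\overline{\mathcal R(g)(t)}\,\mathrm dt . $$
   Context: $S^1$ is identified with $\mathbb R/2\pi\mathbb Z$. For $a\geqslant0$ let $\gamma:S^1\to\mathbb C$, $\gamma(t)=\mathrm e^{\mathrm it}\left(1+a\cos(3t)-3\mathrm i a\sin(3t)\right)$, and for $k\in\mathbb Z$ let $\gamma_k(t)=\gamma(kt)$. For $a\in(0,\tfrac13)$ the operator $\mathcal R:L^2(S^1,\mathbb C)\to L^2(S^1,\mathbb C)$ is defined by the $L^2$-convergent series $$ \mathcal R(y)(t)=\sum_{\ell=0}^\infty(-1)^\ell\,\frac{\left(a+\sqrt{a^2+a}\right)^{\ell+1}-\left(a-\sqrt{a^2+a}\right)^{\ell+1}}{2\sqrt{a^2+a}}\;y\left((-1)^\ell 2^\ell t\right), $$ and for $a=0$, $\mathcal R$ is the identity. It is the inverse of the bounded operator $\mathcal T(f)(t)=f(t)+2a f(-2t)-a f(4t)$ on $L^2(S^1,\mathbb C)$. The inner product $\langle\!\langle\cdot,\cdot\rangle\!\rangle$ is the pullback under $\mathcal R$ of the standard inner product $\langle f,g\rangle=\frac1{2\pi}\int_0^{2\pi}f\overline g\,\mathrm dt$. *)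

(* Defs.v *)
From HB Require Import structures.
From mathcomp Require Import all_boot all_order all_algebra.
From mathcomp Require Import complex.
From mathcomp Require Import all_classical all_reals all_analysis.
From mathcomp Require Import measurable_realfun ring.

Set Implicit Arguments.
Unset Strict Implicit.
Unset Printing Implicit Defensive.

Import Order.TTheory GRing.Theory Num.Theory.
Import numFieldNormedType.Exports.

Local Open Scope classical_set_scope.
Local Open Scope ring_scope.
Local Open Scope complex_scope.
Local Open Scope quotient_scope.

Section CircleFunctions.
Variable R : realType.
Implicit Types f g : R -> R[i].

Definition period : set R := `[0, 2 * pi]%classic.

Definition periodic_2pi f := forall t, f (t + 2 * pi) = f t.

Definition measurable_cfun f :=
  measurable_fun setT (@complex.Re R \o f) /\
  measurable_fun setT (@complex.Im R \o f).

Definition sqnorm f : \bar R :=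
  (\int[lebesgue_measure]_(t in period) (Normc.normc (f t) ^+ 2)%:E)%E.

(* Functions on S^1 = R / 2 pi Z are 2pi-periodic functions on R. *)
Definition square_integrable : {pred R -> R[i]} :=
  mem [set f | [/\ periodic_2pi f, measurable_cfun f & (sqnorm f < +oo)%E]].

Lemma normc2E (z : R[i]) :
  Normc.normc z ^+ 2 = complex.Re z ^+ 2 + complex.Im z ^+ 2.
Proof. by case: z => x y /=; rewrite sqr_sqrtr// addr_ge0// sqr_ge0. Qed.

Lemma measurable_normc2 f : measurable_cfun f ->
  measurable_fun setT (fun t => Normc.normc (f t) ^+ 2).
Proof.
move=> [mr mi].
rewrite (_ : (fun t => _) = (fun t => complex.Re (f t) ^+ 2 + complex.Im (f t) ^+ 2)).
  by apply: measurable_funD; apply: measurable_funX.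
by apply/funext => t; rewrite normc2E.
Qed.

Lemma measurable_cfunZD (c : R[i]) f g :
  measurable_cfun f -> measurable_cfun g -> measurable_cfun (c *: f + g).
Proof.
move=> [mfr mfi] [mgr mgi]; split.
- rewrite (_ : _ \o _ = (fun t => complex.Re c * complex.Re (f t) -
      complex.Im c * complex.Im (f t) + complex.Re (g t))).
    apply: measurable_funD => //; apply: measurable_funB;
      by apply: measurable_funM => //; exact: measurable_cst.
  by apply/funext => t /=; rewrite !fctE; case: c (f t) (g t) => [? ?] [? ?] [? ?].
- rewrite (_ : _ \o _ = (fun t => complex.Re c * complex.Im (f t) +
      complex.Im c * complex.Re (f t) + complex.Im (g t))).
    apply: measurable_funD => //; apply: measurable_funD;
      by apply: measurable_funM => //; exact: measurable_cst.
  by apply/funext => t /=; rewrite !fctE; case: c (f t) (g t) => [? ?] [? ?] [? ?].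
Qed.

Lemma normc2_ZD (c z w : R[i]) : Normc.normc (c * z + w) ^+ 2 <=
  2 * Normc.normc c ^+ 2 * Normc.normc z ^+ 2 + 2 * Normc.normc w ^+ 2.
Proof.
rewrite !normc2E; case: c z w => [c d] [x y] [u v] /=.
have -> : 2 * (c ^+ 2 + d ^+ 2) * (x ^+ 2 + y ^+ 2) + 2 * (u ^+ 2 + v ^+ 2) =
   ((c * x - d * y + u) ^+ 2 + (c * y + d * x + v) ^+ 2) +
   ((c * x - d * y - u) ^+ 2 + (c * y + d * x - v) ^+ 2) by ring.
by rewrite lerDl addr_ge0// sqr_ge0.
Qed.

Lemma sqnorm_ZD (c : R[i]) f g : measurable_cfun f -> measurable_cfun g ->
  (sqnorm (c *: f + g)%R <=
    (2 * Normc.normc c ^+ 2)%R%:E * sqnorm f + 2%:E * sqnorm g)%E.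
Proof.
move=> mf mg.
have mp : measurable (period : set (measurableTypeR R)) by exact: measurable_itv.
have mE h : measurable_cfun h ->
    measurable_fun period (fun t => (Normc.normc (h t) ^+ 2)%:E).
  move=> mh; apply/measurable_EFinP; apply: measurable_funTS.
  exact: measurable_normc2.
rewrite /sqnorm -ge0_integralZl//=; [|exact: mE|by move=> t _; rewrite lee_fin sqr_ge0|by rewrite lee_fin mulr_ge0// sqr_ge0].
rewrite -ge0_integralZl//=; [|exact: mE|by move=> t _; rewrite lee_fin sqr_ge0].
rewrite -ge0_integralD//=.
- apply: ge0_le_integral => //=.
  + by move=> t _; rewrite lee_fin sqr_ge0.
  + by apply: mE; exact: measurable_cfunZD.
  + apply: emeasurable_funD; apply: emeasurable_funM => //; exact: mE.
  + by move=> t _; rewrite -!EFinM -EFinD lee_fin; exact: normc2_ZD.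
- by move=> t _; rewrite -EFinM lee_fin mulr_ge0 ?sqr_ge0// mulr_ge0 ?sqr_ge0.
- by apply: emeasurable_funM => //; exact: mE.
- by move=> t _; rewrite -EFinM lee_fin mulr_ge0 ?sqr_ge0.
- by apply: emeasurable_funM => //; exact: mE.
Qed.

Lemma square_integrable_submod : submod_closed square_integrable.
Proof.
split.
- rewrite inE /=; split; first by [].
  + by split; exact: measurable_cst.
  + rewrite /sqnorm integral0_eq ?ltry// => t _.
    by rewrite normc2E /= expr0n /= addr0.
- move=> c f g; rewrite !inE /= => -[pf mf nf] [pg mg ng]; split.
  + by move=> t; rewrite !fctE pf pg.
  + exact: measurable_cfunZD.
  + apply: (le_lt_trans (sqnorm_ZD c mf mg)).
    by rewrite lte_add_pinfty// lte_mul_pinfty// lee_fin mulr_ge0// sqr_ge0.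
Qed.

End CircleFunctions.

Section L2.
Variable R : realType.

Record sqint : Type := Sqint {
  sqint_fun :> R -> R[i];
  sqint_funP : sqint_fun \in @square_integrable R }.

HB.instance Definition _ := [isSub for sqint_fun].
HB.instance Definition _ := [Choice of sqint by <:].
HB.instance Definition _ := GRing.SubChoice_isSubLmodule.Build R[i] (R -> R[i])
  (@square_integrable R) sqint
  (GRing.submod_closed_semi (@square_integrable_submod R)).

Definition null_sqint : {pred sqint} :=
  mem [set f : sqint | ae_eq lebesgue_measure (@period R) f (fun=> 0)].

Lemma null_sqint_submod : submod_closed null_sqint.
Proof.
split; first by rewrite inE /=; apply: aeW => t.
move=> c f g; rewrite !inE /= => nf ng.
move: nf ng; apply: filterS2 => t nf ng pt.
by rewrite !fctE (nf pt) (ng pt) scaler0 addr0.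
Qed.

HB.instance Definition _ := GRing.isSubmodClosed.Build _ _ null_sqint
  null_sqint_submod.

Definition L2 : Type := Quotient.quot null_sqint.
HB.instance Definition _ := GRing.Zmodule.on L2.
HB.instance Definition _ := EqQuotient.on L2.


Definition L2_scale (c : R[i]) (f : L2) : L2 := \pi_L2 (c *: repr f).

Lemma pi_L2_scale (c : R[i]) (f : sqint) :
  \pi_L2 (c *: f) = L2_scale c (\pi_L2 f).
Proof.
apply/eqP; rewrite -Quotient.idealrBE -scalerBr.
by apply: rpredZ; rewrite Quotient.idealrBE reprK; exact: eqxx.
Qed.

Let L2_scaleA (a b : R[i]) (f : L2) :
  L2_scale a (L2_scale b f) = L2_scale (a * b) f.
Proof.
rewrite -[f]reprK -(pi_L2_scale b (repr f)) -(pi_L2_scale a) -(pi_L2_scale (a * b)).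
by rewrite scalerA.
Qed.

Let L2_scale1 : left_id 1 L2_scale.
Proof. by move=> f; rewrite -[f]reprK -pi_L2_scale scale1r. Qed.

Let L2_scaleDr : right_distributive L2_scale +%R.
Proof.
move=> a f g; rewrite -[f]reprK -[g]reprK.
by rewrite -(@pi_addr _ _ _ _ _ L2) -!pi_L2_scale scalerDr (@pi_addr _ _ _ _ _ L2).
Qed.

Let L2_scaleDl (f : L2) : {morph L2_scale^~ f : a b / a + b}.
Proof.
move=> a b; rewrite -[f]reprK -!pi_L2_scale scalerDl.
by rewrite (@pi_addr _ _ _ _ _ L2).
Qed.

HB.instance Definition _ := GRing.Zmodule_isLmodule.Build R[i] L2
  L2_scaleA L2_scale1 L2_scaleDr L2_scaleDl.

Definition L2_of (f : R -> R[i]) (Hf : f \in @square_integrable R) : L2 :=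
  \pi_L2 (Sqint Hf).

Definition cintegral (D : set R) (f : R -> R[i]) : R[i] :=
  (\int[lebesgue_measure]_(t in D) complex.Re (f t)) +i*
  (\int[lebesgue_measure]_(t in D) complex.Im (f t)).

Definition L2_fun (f : L2) : R -> R[i] := repr f : sqint.

(* Independent of the representatives chosen by [L2_fun]. *)
Definition L2_ip (f g : L2) : R[i] :=
  (2 * pi)^-1%:C * cintegral (@period R) (fun t => L2_fun f t * (L2_fun g t)^*).

End L2.

Section Curve.
Variable R : realType.
Implicit Types (a t : R) (k : int).

Definition cexp t : R[i] := cos t +i* sin t.

Definition gamma a t : R[i] :=
  cexp t * (1 + (a * cos (3 * t))%:C - 3 * 'i * (a * sin (3 * t))%:C).

Definition gammak a k t : R[i] := gamma a (k%:~R * t).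

Lemma gammaE a t : gamma a t =
  (cos t * (1 + a * cos (3 * t)) + 3 * a * sin t * sin (3 * t)) +i*
  (sin t * (1 + a * cos (3 * t)) - 3 * a * cos t * sin (3 * t)).
Proof.
have three : 3 = 3%:R +i* 0 :> R[i] by rewrite -[RHS]/(3%:R%:C) rmorph_nat.
rewrite /gamma /cexp three; apply/eqP; rewrite eq_complex /=.
by apply/andP; split; apply/eqP; ring.
Qed.

Lemma continuous_gammak a k :
  continuous (fun t => complex.Re (gammak a k t)) /\
  continuous (fun t => complex.Im (gammak a k t)).
Proof.
have cM (c : R) : continuous (fun t : R => c * t).
  by move=> x; apply: cvgM; [exact: cvg_cst|exact: cvg_id].
have cc (c : R) : continuous (fun t : R => cos (c * t)).
  by move=> x; apply: continuous_comp; [exact: cM|exact: continuous_cos].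
have cs (c : R) : continuous (fun t : R => sin (c * t)).
  by move=> x; apply: continuous_comp; [exact: cM|exact: continuous_sin].
have K : forall c : R, continuous (cst c : R -> R) by move=> c x; exact: cvg_cst.
split => x.
- under eq_fun do rewrite /gammak gammaE /= !mulrA.
  apply: cvgD; apply: cvgM; [exact: cc| |apply: cvgM; [exact: K|exact: cs]|exact: cs].
  by apply: cvgD; [exact: K|apply: cvgM; [exact: K|exact: cc]].
- under eq_fun do rewrite /gammak gammaE /= !mulrA.
  apply: cvgB; apply: cvgM; [exact: cs| |apply: cvgM; [exact: K|exact: cc]|exact: cs].
  by apply: cvgD; [exact: K|apply: cvgM; [exact: K|exact: cc]].
Qed.

Lemma periodic_shift (f : R -> R) k t :
  (forall x, f (x + 2 * pi) = f x) -> f (t + k%:~R * (2 * pi)) = f t.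
Proof.
move=> pf.
have pn (n : nat) x : f (x + n%:R * (2 * pi)) = f x.
  elim: n x => [|n IH] x; first by rewrite mul0r addr0.
  by rewrite -natr1 mulrDl mul1r addrA pf IH.
case: k => n; first exact: pn.
rewrite NegzE -[LHS](pn n.+1) intrN mulNr -[n.+1%:~R]/(n.+1%:R).
by congr f; ring.
Qed.

Lemma gammak_square_integrable a k : gammak a k \in @square_integrable R.
Proof.
have [cr ci] := continuous_gammak a k.
rewrite inE /=; split.
- move=> t.
  have pc x : cos (x + 2 * pi) = cos x :> R by rewrite mulr_natl cosD2pi.
  have ps x : sin (x + 2 * pi) = sin x :> R by rewrite mulr_natl sinD2pi.
  rewrite /gammak !gammaE (mulrDr k%:~R).
  rewrite (_ : 3 * (k%:~R * t + _) =
    3 * (k%:~R * t) + (3 * k)%:~R * (2 * pi)); last first.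
    by rewrite rmorphM rmorph_nat /=; ring.
  by rewrite !(periodic_shift _ _ pc) !(periodic_shift _ _ ps).
- by split; exact: continuous_measurable_fun.
- rewrite /sqnorm.
  have /integrableP[_] : lebesgue_measure.-integrable (@period R)
      (EFin \o (fun t => Normc.normc (gammak a k t) ^+ 2)).
    apply: continuous_compact_integrable; first exact: segment_compact.
    apply: continuous_subspaceT => x.
    under eq_fun do rewrite normc2E !expr2.
    by apply: cvgD; apply: cvgM; [exact: cr|exact: cr|exact: ci|exact: ci].
  under eq_integral do rewrite /= ger0_norm ?sqr_ge0//.
  by [].
Qed.

Definition L2_gamma a k : L2 R := L2_of (gammak_square_integrable a k).

Definition Rcoef a (l : nat) : R :=
  (-1) ^+ l * (((a + Num.sqrt (a ^+ 2 + a)) ^+ l.+1 -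
                (a - Num.sqrt (a ^+ 2 + a)) ^+ l.+1) /
               (2 * Num.sqrt (a ^+ 2 + a))).

Definition Rpartial a (y : R -> R[i]) (n : nat) t : R[i] :=
  \sum_(l < n) (Rcoef a l)%:C * y ((-1) ^+ l * 2 ^+ l * t).

(* For a <> 0, the limit in L^2 of the partial sums.  The dilations
   t |-> (-1)^l 2^l t preserve null sets, so the partial sums of two
   representatives agree a.e. and the choice made by [L2_fun] is immaterial;
   the limit is unique in L2, and the value 0 of [xget] is only reached when
   there is none. *)
Definition Rop a (y : L2 R) : L2 R :=
  if a == 0 then y
  else xget 0 [set z : L2 R |
    sqnorm (fun t => Rpartial a (L2_fun y) n t - L2_fun z t)
      @[n --> \oo] --> 0%E].

Definition Rop_ip a (f g : L2 R) : R[i] := L2_ip (Rop a f) (Rop a g).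

End Curve.

Section HilbertBasis.
Variables (C : numClosedFieldType) (V : lmodType C) (ip : {dot V for Num.conj}).

Definition orthonormal_family (I : eqType) (e : I -> V) :=
  forall i j, ip (e i) (e j) = (i == j)%:R.

Definition dense_span (I : eqType) (e : I -> V) :=
  forall (v : V) (eps : C), 0 < eps ->
    exists (s : seq I) (c : I -> C),
      let w := v - \sum_(i <- s) c i *: e i in sqrtC (ip w w) < eps.

Definition hilbert_basis (I : eqType) (e : I -> V) :=
  orthonormal_family e /\ dense_span e.

End HilbertBasis.

(* Main.v *)
Require Import Defs.
From HB Require Import structures.
From mathcomp Require Import all_boot all_order all_algebra.
From mathcomp Require Import complex.
From mathcomp Require Import all_classical all_reals all_analysis.
From mathcomp Require Import measurable_realfun ring lra.

Set Implicit Arguments.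
Unset Strict Implicit.
Unset Printing Implicit Defensive.

Import Order.TTheory GRing.Theory Num.Theory.
Import numFieldNormedType.Exports.

Local Open Scope classical_set_scope.
Local Open Scope ring_scope.
Local Open Scope complex_scope.
Local Open Scope quotient_scope.

(** Let U f(t) = f(-2 t), e_k(t) = exp(i k t) and T = 1 + 2 a U - a U^2.  Euler's
formulas give gamma_k = T e_k (gammak_Tf), so everything rests on inverting T.

U is an isometry of L^2(S^1): the map t |-> -2 t winds the circle twice around
itself, doubling lengths (sqnorm_flip).  With s = sqrt (a^2 + a) the polynomial
1 + 2 a X - a X^2 factors as (1 + (a + s) X) (1 + (a - s) X), and the coefficients
of the series defining R are (for a > 0) those of its inverse power series.  The condition
a < 1/3 says exactly that a + s < 1; the coefficients then decay geometrically
(Rcoef_le), the Neumann series converges in L^2 (geometric_series_sqnorm_cvg), and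
the telescoping identity Rpartial_Tf shows that its sum inverts T on both sides
(Rop_Tf and Rop_ex).  Hence R is linear and injective on L^2, the pullback of the
standard inner product is again an inner product (Rop_dot), and R gamma_k = e_k
(Rop_gamma).

Orthonormality of the gamma_k is thus orthonormality of the exponentials, and if a
trigonometric polynomial p = sum c_k e_k is close to R v, then sum c_k gamma_k is
equally close to v for the pulled back norm.  It remains to know that trigonometric
polynomials are dense in L^2 (trigpoly_dense).  The functions approximable by them
form a linear space closed under dominated limits.  For 0 < b < 2 pi the arc (0, b)
is the set where cos (t - b/2) exceeds cos (b/2), and explicit polynomials
converging boundedly to a step function, evaluated at cos (t - b/2), approximate its
indicator.  The pi-lambda theorem extends this to all Borel sets, and simple
functions to all square integrable functions.

Elements of L^2 are handled through the relation is_class y f: the function f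
represents the class y. *)

(** * The square norm and classes of square integrable functions *)

Section SquareNorm.
Variable R : realType.
Local Notation mu := (@lebesgue_measure R).
Implicit Types (f g h : R -> R[i]) (c : R[i]).

Lemma measurable_period : measurable (@period R : set (measurableTypeR R)).
Proof. exact: measurable_itv. Qed.
Hint Resolve measurable_period : core.

Lemma normc_sqr_ge0 (z : R[i]) : 0 <= Normc.normc z ^+ 2.
Proof. exact: sqr_ge0. Qed.
Hint Resolve normc_sqr_ge0 : core.

Lemma normc2M (z w : R[i]) :
  Normc.normc (z * w) ^+ 2 = Normc.normc z ^+ 2 * Normc.normc w ^+ 2.
Proof. by rewrite Normc.normcM exprMn. Qed.

Lemma measurable_EFin_normc2 f : measurable_cfun f ->
  measurable_fun (@period R) (fun t => (Normc.normc (f t) ^+ 2)%:E).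
Proof.
move=> mf; apply/measurable_EFinP; apply: measurable_funTS.
exact: measurable_normc2.
Qed.

Lemma sqnorm_ge0 f : (0 <= sqnorm f)%E.
Proof. by apply: integral_ge0 => t _; rewrite lee_fin. Qed.
Hint Resolve sqnorm_ge0 : core.

Lemma ae_eq_sqnorm f g : measurable_cfun f -> measurable_cfun g ->
  ae_eq mu (@period R) f g -> sqnorm f = sqnorm g.
Proof.
move=> mf mg fg; apply: ge0_ae_eq_integral => //.
- exact: measurable_EFin_normc2.
- exact: measurable_EFin_normc2.
- by move=> t _; rewrite lee_fin.
- by move=> t _; rewrite lee_fin.
- by move: fg; apply: filterS => t fg pt; rewrite fg.
Qed.

Lemma sqnorm_eq0P f : measurable_cfun f ->
  sqnorm f = 0%E <-> ae_eq mu (@period R) f (fun=> 0).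
Proof.
move=> mf; split => [f0|f0]; last first.
  rewrite (ae_eq_sqnorm mf _ f0); last by split; exact: measurable_cst.
  by apply: integral0_eq => t _; rewrite Normc.normc0 expr0n.
have /= : (\int[mu]_(t in @period R) `|(Normc.normc (f t) ^+ 2)%:E| = 0)%E.
  rewrite -[RHS]f0; apply: eq_integral => t _.
  by rewrite /= ger0_norm.
move/(ae_eq_integral_abs mu measurable_period (measurable_EFin_normc2 mf)).
apply: filterS => t H pt; have [] := H pt.
by move/eqP; rewrite sqrf_eq0 => /eqP/Normc.eq0_normc.
Qed.

Lemma measurable_cfunD f g : measurable_cfun f -> measurable_cfun g ->
  measurable_cfun (f + g).
Proof. by move=> mf mg; rewrite -(scale1r f); exact: measurable_cfunZD. Qed.

Lemma measurable_cfun0 : measurable_cfun (0 : R -> R[i]).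
Proof. by split; exact: measurable_cst. Qed.

Lemma sqnorm0 : sqnorm (0 : R -> R[i]) = 0%E.
Proof. by apply/(sqnorm_eq0P measurable_cfun0); exact: aeW. Qed.

Lemma measurable_cfunZ c f : measurable_cfun f -> measurable_cfun (c *: f).
Proof.
by move=> mf; rewrite -[_ *: _]addr0; apply: measurable_cfunZD => //; exact: measurable_cfun0.
Qed.

Lemma measurable_cfunN f : measurable_cfun f -> measurable_cfun (- f).
Proof. by move=> mf; rewrite -scaleN1r; exact: measurable_cfunZ. Qed.

Lemma measurable_cfunB f g : measurable_cfun f -> measurable_cfun g ->
  measurable_cfun (f - g).
Proof. by move=> mf mg; apply: measurable_cfunD => //; exact: measurable_cfunN. Qed.

Lemma sqnormZ c f : measurable_cfun f ->
  sqnorm (c *: f) = ((Normc.normc c ^+ 2)%:E * sqnorm f)%E.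
Proof.
move=> mf; rewrite /sqnorm -ge0_integralZl//=.
- by apply: eq_integral => t _; rewrite !fctE -EFinM -normc2M.
- exact: measurable_EFin_normc2.
- by move=> t _; rewrite lee_fin.
- by rewrite lee_fin.
Qed.

Lemma sqnormN f : sqnorm (- f) = sqnorm f.
Proof.
by apply: eq_integral => t _; rewrite !fctE !normc2E; case: (f t) => x y /=; rewrite !sqrrN.
Qed.

Lemma sqnormBC f g : sqnorm (f - g) = sqnorm (g - f).
Proof. by rewrite -sqnormN opprB. Qed.

Lemma sqnormD f g : measurable_cfun f -> measurable_cfun g ->
  (sqnorm (f + g)%R <= 2%:E * sqnorm f + 2%:E * sqnorm g)%E.
Proof.
move=> mf mg; have := sqnorm_ZD 1 mf mg; rewrite scale1r.
by rewrite Normc.normc1 expr1n mulr1.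
Qed.

(** Replaces the triangle inequality: the factor 2 is harmless for limits, and the
square root is avoided. *)
Lemma sqnorm_split f g h : measurable_cfun f -> measurable_cfun g -> measurable_cfun h ->
  (sqnorm (f - g)%R <= 2%:E * sqnorm (f - h)%R + 2%:E * sqnorm (g - h)%R)%E.
Proof.
move=> mf mg mh; rewrite (sqnormBC g) (_ : f - g = (f - h) + (h - g)); last first.
  by rewrite addrA subrK.
by apply: sqnormD; exact: measurable_cfunB.
Qed.

Lemma sqnorm_split0 f g h : measurable_cfun f -> measurable_cfun g -> measurable_cfun h ->
  sqnorm (f - h) = 0%E -> sqnorm (g - h) = 0%E -> sqnorm (f - g) = 0%E.
Proof.
move=> mf mg mh f0 g0; apply/eqP; rewrite eq_le sqnorm_ge0 andbT.
by rewrite (le_trans (sqnorm_split mf mg mh))// f0 g0 !mule0 adde0.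
Qed.

Lemma sqiP f : f \in @square_integrable R <->
  [/\ periodic_2pi f, measurable_cfun f & (sqnorm f < +oo)%E].
Proof. by rewrite inE. Qed.

Lemma sqi_measurable f : f \in @square_integrable R -> measurable_cfun f.
Proof. by case/sqiP. Qed.

Lemma sqi_fin f : f \in @square_integrable R -> (sqnorm f < +oo)%E.
Proof. by case/sqiP. Qed.

Lemma sqi_periodic f : f \in @square_integrable R -> periodic_2pi f.
Proof. by case/sqiP. Qed.

Lemma sqiZD c f g : f \in @square_integrable R -> g \in @square_integrable R ->
  c *: f + g \in @square_integrable R.
Proof. by move=> sf sg; apply: (square_integrable_submod R).2. Qed.

Lemma sqi0 : 0 \in @square_integrable R.
Proof. exact: (square_integrable_submod R).1. Qed.

Lemma sqiZ c f : f \in @square_integrable R -> c *: f \in @square_integrable R.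
Proof. by move=> sf; rewrite -[_ *: _]addr0; apply: sqiZD => //; exact: sqi0. Qed.

Lemma sqiD f g : f \in @square_integrable R -> g \in @square_integrable R ->
  f + g \in @square_integrable R.
Proof. by move=> sf sg; rewrite -[f]scale1r; exact: sqiZD. Qed.

Lemma sqiB f g : f \in @square_integrable R -> g \in @square_integrable R ->
  f - g \in @square_integrable R.
Proof. by move=> sf sg; rewrite addrC -scaleN1r; exact: sqiZD. Qed.

End SquareNorm.
#[global] Hint Extern 0 (is_true (_ <= sqnorm _)%E) => solve [apply: sqnorm_ge0] : core.
#[global] Hint Extern 0 (is_true (_ <= Normc.normc _ ^+ 2)) => solve [apply: sqr_ge0] : core.
#[global] Hint Extern 0 (measurable (period (R := _))) => solve [apply:
  measurable_period] : core.

Section Classes.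
Variable R : realType.
Implicit Types (f g h : R -> R[i]) (c : R[i]) (y z : L2 R).

(** The choice of representative made by [L2_fun] is hidden behind this relation,
whose second component is almost everywhere equality by [sqnorm_eq0P]. *)
Definition is_class y f :=
  f \in @square_integrable R /\ sqnorm (L2_fun y - f) = 0%E.

Lemma L2_funP y : L2_fun y \in @square_integrable R.
Proof. exact: sqint_funP. Qed.

Lemma pi_L2_eq (f g : sqint R) :
  \pi_(L2 R) f = \pi_(L2 R) g <-> sqnorm (sqint_fun f - sqint_fun g) = 0%E.
Proof.
rewrite sqnorm_eq0P; last by apply: measurable_cfunB; apply: sqi_measurable; exact: sqint_funP.
split => [fg|fg].
- have : f - g \in @null_sqint R.
    by rewrite Quotient.idealrBE; apply/eqP; exact: fg.
  by rewrite inE.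
- apply/eqP; rewrite -Quotient.idealrBE inE /=; exact: fg.
Qed.

Lemma is_class_fun y : is_class y (L2_fun y).
Proof.
split; first exact: L2_funP.
by rewrite subrr sqnorm0.
Qed.

Lemma is_class_pi (f : sqint R) : is_class (\pi_(L2 R) f) f.
Proof.
split; first exact: sqint_funP.
by apply/pi_L2_eq; rewrite reprK.
Qed.

Lemma is_class_of f (Hf : f \in @square_integrable R) : is_class (L2_of Hf) f.
Proof. exact: (is_class_pi (Sqint Hf)). Qed.

Lemma is_class_eq y z f g : is_class y f -> is_class z g ->
  y = z <-> sqnorm (f - g) = 0%E.
Proof.
move=> [sf yf] [sg zg].
have my := sqi_measurable (L2_funP y); have mz := sqi_measurable (L2_funP z).
have mf := sqi_measurable sf; have mg := sqi_measurable sg.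
have E : y = z <-> sqnorm (L2_fun y - L2_fun z) = 0%E.
  by rewrite -pi_L2_eq !reprK.
rewrite E; split => H.
- apply: (@sqnorm_split0 _ _ _ (L2_fun z)) => //; last by rewrite sqnormBC.
  by apply: (@sqnorm_split0 _ _ _ (L2_fun y)) => //; rewrite sqnormBC.
- apply: (@sqnorm_split0 _ _ _ g) => //.
  apply: (@sqnorm_split0 _ _ _ f) => //.
  by rewrite sqnormBC.
Qed.

Lemma is_class_ex f : f \in @square_integrable R -> exists y, is_class y f.
Proof. by move=> sf; exists (L2_of sf); exact: is_class_of. Qed.

Lemma is_class_lin c y z f g : is_class y f -> is_class z g ->
  is_class (c *: y + z) (c *: f + g).
Proof.
move=> yf zg.
have [sf _] := yf; have [sg _] := zg.
have -> : c *: y + z = \pi_(L2 R) (c *: Sqint sf + Sqint sg : sqint R).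
  rewrite (@pi_addr _ _ _ _ _ (L2 R)) pi_L2_scale.
  congr (_ *: _ + _).
    apply/(is_class_eq yf (is_class_pi (Sqint sf))) => /=.
    by rewrite subrr sqnorm0.
  apply/(is_class_eq zg (is_class_pi (Sqint sg))) => /=.
  by rewrite subrr sqnorm0.
exact: is_class_pi.
Qed.

Lemma is_class0 : is_class 0 0.
Proof. by have := is_class_lin (-1) (is_class_fun 0) (is_class_fun 0);
  rewrite !scaleN1r !addNr. Qed.

Lemma is_class_uniq y z f : is_class y f -> is_class z f -> y = z.
Proof.
move=> yf zf; apply/(is_class_eq yf zf).
by rewrite subrr sqnorm0.
Qed.

Lemma is_class_sum (I : Type) (s : seq I) (c : I -> R[i]) (y : I -> L2 R) (f : I -> R -> R[i]) :
  (forall i, is_class (y i) (f i)) ->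
  is_class (\sum_(i <- s) c i *: y i) (\sum_(i <- s) c i *: f i).
Proof.
move=> yf; elim: s => [|i s IH]; first by rewrite !big_nil; exact: is_class0.
by rewrite !big_cons; exact: is_class_lin.
Qed.

End Classes.

(** * The dilation by -2 is an isometry *)

Section Dilation.
Variable R : realType.
Local Notation mu := (@lebesgue_measure R).
Local Notation mR := (measurableTypeR R).

(** The translation part d selects the branch: on each half of the period, -2 t + d
with a suitable d is a bijection onto the whole period. *)
Definition flip2 (d : R) : mR -> mR := fun t => -2 * t + d.

Lemma measurable_flip2 d : measurable_fun setT (flip2 d).
Proof.
apply: measurable_funD; last exact: measurable_cst.
by apply: measurable_funM; [exact: measurable_cst|exact: measurable_id].
Qed.

Definition flip2_measure (d : R) : {measure set mR -> \bar R}.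
Proof.
unshelve refine [the {measure set mR -> \bar R} of pushforward mu (flip2 d)].
exact: measurable_flip2.
Defined.

(** Both sides are measures, so by uniqueness of the Lebesgue measure it is enough to
compare them on intervals, whose length the map doubles. *)
Lemma lebesgue_measure_flip2 d (A : set mR) : measurable A ->
  mu A = mscale 2%:nng (flip2_measure d) A.
Proof.
move=> mA; apply: lebesgue_measure_unique => // _ [[a b]] _ <-.
transitivity (2%:E * mu (flip2 d @^-1` `]a, b]))%E; last by [].
have -> : flip2 d @^-1` `]a, b] = `[(d - b) / 2, (d - a) / 2[%classic.
  apply/seteqP; split => t /=; rewrite !in_itv /flip2 /= => /andP[? ?]; apply/andP; split; lra.
rewrite !lebesgue_measure_itv/= !lte_fin.
have -> : ((d - b) / 2 < (d - a) / 2) = (a < b) by apply/idP/idP; lra.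
case: ifP => _; last by rewrite mule0.
by rewrite -EFinM; congr EFin; lra.
Qed.

Lemma ge0_integral_flip2 d (D : set mR) (h : mR -> \bar R) :
  measurable D -> measurable_fun setT h -> (forall t, 0 <= h t)%E ->
  (\int[mu]_(t in D) h t =
    2%:E * \int[mu]_(t in flip2 d @^-1` D) h (flip2 d t))%E.
Proof.
move=> mD mh h0.
rewrite -(@ge0_integral_pushforward _ _ _ _ _ _ (measurable_flip2 d) mu D h)//;
  last exact: measurable_funTS.
rewrite -[pushforward _ _]/(flip2_measure d : set mR -> \bar R).
transitivity (\int[mscale (2%:nng)%R (flip2_measure d)]_(t in D) h t)%E; last first.
  by rewrite ge0_integral_mscale//; exact: measurable_funTS.
by apply: eq_measure_integral => A mA _; exact: lebesgue_measure_flip2.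
Qed.

(** The period splits into two halves, each of which -2 t + d covers once (d = 2 pi on
the first half, d = 4 pi on the second); by periodicity the two halves contribute
equally, and the Jacobian 2 makes up for covering the period twice. *)
Lemma ge0_integral_period_flip (h : mR -> \bar R) :
  measurable_fun setT h -> (forall t, 0 <= h t)%E ->
  (forall t, h (t + 2 * pi) = h t) ->
  (\int[mu]_(t in @period R) h (-2 * t)%R = \int[mu]_(t in @period R) h t)%E.
Proof.
move=> mh h0 hp.
have pi0 : 0 < (pi : R) := pi_gt0 R.
have mhf : measurable_fun setT (fun t : mR => h (-2 * t)).
  rewrite (_ : (fun t => _) = h \o flip2 0);
    first exact: (measurableT_comp mh (measurable_flip2 0)).
  by apply/funext => t; rewrite /flip2 /= addr0.
have -> : (@period R) = `[0, pi] `|` `]pi, 2 * pi].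
  apply/seteqP; split => t; rewrite /period /= !in_itv /=.
    by move=> /andP[t0 t2]; case: (leP t pi) => tp; [left; rewrite t0|right; rewrite t2].
  by case=> /andP[? ?]; apply/andP; split; lra.
rewrite ge0_integral_setU//=; first last.
- apply/disj_setPS => t /=; rewrite !in_itv /= => -[/andP[_ tp] /andP[]].
  by rewrite ltNge tp.
- exact: measurable_funTS.
have -> : (\int[mu]_(t in `[0%R, pi] `|` `]pi, (2 * pi)%R]) h t =
    \int[mu]_(t in @period R) h t)%E.
  congr (integral _ _ _); apply/seteqP; split => t; rewrite /period /= !in_itv /=.
    by case=> /andP[? ?]; apply/andP; split; lra.
  by move=> /andP[t0 t2]; case: (leP t pi) => tp; [left; rewrite t0|right; rewrite t2].
have half d (D : set mR) : measurable D -> flip2 d @^-1` (@period R) = D ->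
    (forall t : R, h (-2 * t) = h (flip2 d t)) ->
    (2%:E * \int[mu]_(t in D) h (-2 * t)%R = \int[mu]_(t in @period R) h t)%E.
  move=> mD <- hd; rewrite [RHS](@ge0_integral_flip2 d)//.
  by congr (_ * _)%E; apply: eq_integral => t _.
have H1 := @half (2 * pi) `[0, pi]%classic.
have H2 := @half (4 * pi) `[pi, 2 * pi]%classic.
rewrite integral_itv_obnd_cbnd; last exact: measurable_funTS.
have E1 : (2%:E * \int[mu]_(t in `[0%R, pi]) h (-2 * t)%R = \int[mu]_(t in @period R) h t)%E.
  apply: H1 => //.
  - apply/seteqP; split => t; rewrite /flip2 /period /= !in_itv /= => /andP[? ?];
      apply/andP; split; lra.
  - by move=> t; rewrite /flip2 hp.
have E2 : (2%:E * \int[mu]_(t in `[pi, (2 * pi)%R]) h (-2 * t)%R =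
  \int[mu]_(t in @period R) h t)%E.
  apply: H2 => //.
  - apply/seteqP; split => t; rewrite /flip2 /period /= !in_itv /= => /andP[? ?];
      apply/andP; split; lra.
  - by move=> t; rewrite /flip2 -[LHS]hp -[LHS]hp; congr h; ring.
set I1 := (\int[mu]_(t in `[0%R, pi]) _)%E in E1 *.
set I2 := (\int[mu]_(t in `[pi, (2 * pi)%R]) _)%E in E2 *.
have I1E : I1 = (2^-1%:E * \int[mu]_(t in @period R) h t)%E.
  by rewrite -E1 muleA -EFinM mulVf ?mul1e.
have I2E : I2 = (2^-1%:E * \int[mu]_(t in @period R) h t)%E.
  by rewrite -E2 muleA -EFinM mulVf ?mul1e.
rewrite I1E I2E -ge0_muleDl ?lee_fin ?invr_ge0//.
by rewrite -EFinD (_ : 2^-1 + 2^-1 = 1 :> R) ?mul1e//; lra.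
Qed.

Implicit Types (f : R -> R[i]).

Lemma measurable_cfun_comp f (phi : mR -> mR) : measurable_fun setT phi ->
  measurable_cfun f -> measurable_cfun (f \o phi).
Proof.
move=> mphi [mr mi]; split.
- exact: (@measurableT_comp _ _ _ _ _ _ _ _ _ mr mphi).
- exact: (@measurableT_comp _ _ _ _ _ _ _ _ _ mi mphi).
Qed.

Lemma measurable_scale (c : R) : measurable_fun setT (fun t : mR => c * t : mR).
Proof. by apply: measurable_funM; [exact: measurable_cst|exact: measurable_id]. Qed.

Lemma sqnorm_flip f : periodic_2pi f -> measurable_cfun f ->
  sqnorm (fun t => f (-2 * t)) = sqnorm f.
Proof.
move=> pf mf.
apply: (@ge0_integral_period_flip (fun t => (Normc.normc (f t) ^+ 2)%:E)).
- by apply/measurable_EFinP; exact: measurable_normc2.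
- by move=> t; rewrite lee_fin sqr_ge0.
- by move=> t; rewrite pf.
Qed.

(** The power [l] of the operator f |-> (t |-> f (-2 t)), written with the factor
used in [Rpartial]. *)
Definition dil (l : nat) f : R -> R[i] := fun t => f ((-1) ^+ l * 2 ^+ l * t).

Lemma dil0 f : dil 0 f = f.
Proof. by apply/funext => t; rewrite /dil !expr0 !mul1r. Qed.

Lemma dilS l f : dil l.+1 f = fun t => dil l f (-2 * t).
Proof. by apply/funext => t; rewrite /dil; congr f; rewrite !exprSr; ring. Qed.

Lemma periodic_flip f : periodic_2pi f -> periodic_2pi (fun t => f (-2 * t)).
Proof.
by move=> pf t; rewrite -[LHS]pf -[LHS]pf; congr f; ring.
Qed.

Lemma dil_facts l f : periodic_2pi f -> measurable_cfun f ->
  [/\ periodic_2pi (dil l f), measurable_cfun (dil l f) & sqnorm (dil l f) = sqnorm f].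
Proof.
move=> pf mf; elim: l => [|l [IH1 IH2 IH3]]; first by rewrite dil0.
rewrite dilS; split.
- exact: periodic_flip.
- exact: (measurable_cfun_comp (measurable_scale (-2))).
- by rewrite sqnorm_flip.
Qed.

Lemma sqi_dil l f : f \in @square_integrable R -> dil l f \in @square_integrable R.
Proof.
by move=> /sqiP[pf mf nf]; have [? ? E] := dil_facts l pf mf; apply/sqiP; split=> //; rewrite E.
Qed.

Lemma sqnorm_dil l f : f \in @square_integrable R -> sqnorm (dil l f) = sqnorm f.
Proof. by move=> /sqiP[pf mf nf]; have [? ? E] := dil_facts l pf mf. Qed.

End Dilation.

(** * Limits in square norm *)

Section SquareNormLimits.
Variable R : realType.
Local Notation mu := (@lebesgue_measure R).
Local Notation mR := (measurableTypeR R).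
Implicit Types (f g h : R -> R[i]) (c : R[i]).

Lemma lebesgue_aeS (P Q : R -> Prop) : (forall t, P t -> Q t) ->
  {ae mu, forall t, P t} -> {ae mu, forall t, Q t}.
Proof. exact: (@filterS _ _ (ae_filter_ringOfSetsType mu)). Qed.

Lemma lebesgue_ae_finite (s : seq R) (P : R -> Prop) :
  (forall t, t \notin s -> P t) -> {ae mu, forall t, P t}.
Proof.
have cs : countable [set` s] := finite_set_countable (finite_seq s).
move=> H; exists [set` s]; split.
- by apply: countable_measurable => // t; exact: measurable_set1.
- exact: countable_lebesgue_measure0.
- by move=> t /= nP; apply: contrapT => ts; apply: nP; apply: H; apply/negP.
Qed.

Lemma sqnorm_cvg0 (u : nat -> R -> R[i]) (G : mR -> \bar R) :
  (forall n, measurable_cfun (u n)) ->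
  measurable_fun (@period R) G -> (forall t, 0 <= G t)%E ->
  (\int[mu]_(t in @period R) G t < +oo)%E ->
  (forall n t, @period R t -> (Normc.normc (u n t) ^+ 2)%:E <= G t)%E ->
  {ae mu, forall t, @period R t -> (fun n => Normc.normc (u n t) ^+ 2) @ \oo --> (0 : R)} ->
  (fun n => sqnorm (u n)) @ \oo --> 0%E.
Proof.
move=> mun mG G0 iG uG u0.
have [] := @dominated_convergence _ _ _ mu (@period R) (@measurable_period R)
  (fun n t => (Normc.normc (u n t) ^+ 2)%:E) (cst 0%E) G.
- by move=> n; exact: measurable_EFin_normc2.
- exact: measurable_cst.
- move: u0; apply: lebesgue_aeS => t H pt; apply: cvg_EFin; first exact: nearW.
  exact: H.
- apply/integrableP; split => //.
  by under eq_integral do rewrite gee0_abs//.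
- apply: aeW => t n pt; rewrite gee0_abs; first exact: uG.
  by rewrite lee_fin sqr_ge0.
by move=> _ _; rewrite integral0.
Qed.

Lemma sqnorm_cvg0P (u : nat -> R -> R[i]) :
  (fun n => sqnorm (u n)) @ \oo --> 0%E ->
  forall e : R, 0 < e -> exists N, forall n, (N <= n)%N -> (sqnorm (u n) < e%:E)%E.
Proof.
move=> u0 e e0.
have /u0 [N _ HN] : nbhs (0%E : \bar R) [set x | (x < e%:E)%E].
  by apply: open_nbhs_nbhs; split; [exact: open_ereal_lt_ereal|rewrite /= lte_fin].
by exists N => n Nn; exact: HN.
Qed.

End SquareNormLimits.

(** * Trigonometric polynomials *)

Section TrigonometricPolynomials.
Variable R : realType.
Implicit Types (f g h p q : R -> R[i]) (c : R[i]) (k : int) (t : R).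

Lemma gammak0E k t : gammak 0 k t = cexp (k%:~R * t).
Proof. by rewrite /gammak /gamma !mul0r mulr0 subr0 addr0 mulr1. Qed.

Lemma cexpD (s t : R) : cexp (s + t) = cexp s * cexp t.
Proof.
by rewrite /cexp cosD sinD; apply/eqP; rewrite eq_complex /=; apply/andP; split; apply/eqP;
  ring.
Qed.

Lemma cexp0 : cexp 0 = 1 :> R[i].
Proof. by rewrite /cexp cos0 sin0. Qed.

(** The frequencies in the list may be repeated, so that the sum of two trigonometric
polynomials is given by the concatenation of their lists. *)
Definition trigpoly p := exists s : seq (R[i] * int),
  p = \sum_(x <- s) x.1 *: gammak 0 x.2.

Lemma trigpoly_mono c k : trigpoly (c *: gammak 0 k).
Proof. by exists [:: (c, k)]; rewrite big_seq1. Qed.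

Lemma trigpoly0 : trigpoly 0.
Proof. by exists [::]; rewrite big_nil. Qed.

Lemma trigpolyD p q : trigpoly p -> trigpoly q -> trigpoly (p + q).
Proof. by move=> [s ->] [s' ->]; exists (s ++ s'); rewrite big_cat. Qed.

Lemma trigpoly_sum (I : Type) (s : seq I) (F : I -> R -> R[i]) :
  (forall i, trigpoly (F i)) -> trigpoly (\sum_(i <- s) F i).
Proof.
move=> H; elim: s => [|i s IH]; first by rewrite big_nil; exact: trigpoly0.
by rewrite big_cons; exact: trigpolyD.
Qed.

Lemma trigpolyZ c p : trigpoly p -> trigpoly (c *: p).
Proof.
move=> [s ->]; rewrite scaler_sumr; apply: trigpoly_sum => x.
by rewrite scalerA; exact: trigpoly_mono.
Qed.

Lemma trigpolyN p : trigpoly p -> trigpoly (- p).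
Proof. by move=> tp; rewrite -scaleN1r; exact: trigpolyZ. Qed.

Lemma trigpoly1 : trigpoly (fun=> 1).
Proof.
rewrite (_ : (fun=> 1) = 1 *: gammak 0 0); first exact: trigpoly_mono.
by apply/funext => t; rewrite fctE gammak0E mul0r cexp0 scaler1.
Qed.

(** Since e_j e_k = e_(j+k). *)
Lemma trigpolyM p q : trigpoly p -> trigpoly q -> trigpoly (fun t => p t * q t).
Proof.
move=> [s ->] [s' ->].
rewrite (_ : (fun t => _) = \sum_(x <- s) \sum_(y <- s') (x.1 * y.1) *: gammak 0 (x.2 + y.2)).
  by do 2 (apply: trigpoly_sum => ?); exact: trigpoly_mono.
apply/funext => t; rewrite !fct_sumE big_distrlr /=; apply: eq_bigr => x _.
rewrite fct_sumE; apply: eq_bigr => y _.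
by rewrite !fctE !gammak0E intrD mulrDl cexpD; rewrite /GRing.scale /=; ring.
Qed.

Lemma trigpolyX p n : trigpoly p -> trigpoly (fun t => p t ^+ n).
Proof.
move=> tp; elim: n => [|n IH].
  by under eq_fun do rewrite expr0; exact: trigpoly1.
by under eq_fun do rewrite exprS; exact: trigpolyM.
Qed.

Lemma trigpoly_sqi p : trigpoly p -> p \in @square_integrable R.
Proof.
move=> [s ->]; elim: s => [|x s IH]; first by rewrite big_nil; exact: sqi0.
by rewrite big_cons; apply: sqiZD => //; exact: gammak_square_integrable.
Qed.

Lemma trigpoly_cos (b : R) : trigpoly (fun t => (cos (t - b))%:C).
Proof.
rewrite (_ : (fun t => _) = (cexp (- b) / 2) *: gammak 0 1 + (cexp b / 2) *: gammak 0 (-1)).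
  by apply: trigpolyD; exact: trigpoly_mono.
apply/funext => t; rewrite !fctE !gammak0E mul1r mulN1r /GRing.scale /=.
have two : 2 = 2%:R%:C :> R[i] by rewrite rmorph_nat.
rewrite [LHS](_ : _ = (cexp (t - b) + cexp (- (t - b))) / 2).
  by rewrite opprB !cexpD; ring.
rewrite two -fmorphV /cexp cosN sinN; apply/eqP; rewrite eq_complex /=.
by apply/andP; split; apply/eqP; field.
Qed.

End TrigonometricPolynomials.

(** * Polynomials converging boundedly to a step function *)

Section StepApproximation.
Variables (R : realType) (h : R).
Hypotheses (h0 : 0 < h) (h1 : h < 1).

(** With m about h^(-n), the product m x^n is close to (x / h)^n, which tends to 0 for
x < h and to infinity for x > h; and 1 - (1 - y)^m is small when m y is small and
close to 1 when m y is large. *)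
Definition step_poly (n : nat) (x : R) : R :=
  1 - (1 - x ^+ n) ^+ Num.truncn (h ^- n).

Lemma step_poly_bound n x : 0 <= x <= 1 -> 0 <= step_poly n x <= 1.
Proof.
move=> /andP[x0 x1]; rewrite /step_poly.
have y0 : 0 <= 1 - x ^+ n by rewrite subr_ge0 exprn_ile1.
have y1 : 1 - x ^+ n <= 1 by rewrite gerBl exprn_ge0.
by rewrite subr_ge0 exprn_ile1//= gerBl exprn_ge0.
Qed.

Lemma bernoulli_ge (y : R) m : -1 <= y -> 1 + m%:R * y <= (1 + y) ^+ m.
Proof.
move=> y1; elim: m => [|m IH]; first by rewrite mul0r addr0 expr0.
have y0 : 0 <= 1 + y by lra.
rewrite exprS; apply: le_trans (ler_wpM2l y0 IH).
rewrite -natr1; have := sqr_ge0 y; rewrite expr2.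
have : 0 <= (m%:R : R) by [].
by nra.
Qed.

(** Bernoulli gives 1 - (1 - y)^m <= m y, and m <= h^(-n). *)
Lemma step_poly_lo n x : 0 <= x <= 1 -> step_poly n x <= (x / h) ^+ n.
Proof.
move=> /andP[x0 x1]; rewrite /step_poly.
have xn0 : 0 <= x ^+ n by rewrite exprn_ge0.
have xn1 : x ^+ n <= 1 by rewrite exprn_ile1.
have hn : 0 <= h ^- n by rewrite invr_ge0 exprn_ge0// ltW.
have B := @bernoulli_ge (- x ^+ n) (Num.truncn (h ^- n)).
have T : (Num.truncn (h ^- n))%:R <= h ^- n by rewrite truncn_le.
rewrite expr_div_n.
apply: (@le_trans _ _ ((Num.truncn (h ^- n))%:R * x ^+ n)).
  by rewrite lerBlDr -lerBlDl; move: B; rewrite mulrN; apply; lra.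
by rewrite mulrC; apply: ler_wpM2l.
Qed.

(** Since (1 - y)^m (1 + y)^m <= 1, Bernoulli bounds (1 - y)^m by the inverse of
1 + m y; here m + 1 >= h^(-n) and y = x^n <= 1, so that 1 + m y >= (x / h)^n. *)
Lemma step_poly_hi n x : 0 < x <= 1 -> 1 - step_poly n x <= (h / x) ^+ n.
Proof.
move=> /andP[x0 x1]; rewrite /step_poly subKr.
have xn0 : 0 < x ^+ n by rewrite exprn_gt0.
have xn1 : x ^+ n <= 1 by rewrite exprn_ile1// ltW.
have hn : 0 < h ^+ n by rewrite exprn_gt0.
set m := Num.truncn _.
have T : h ^- n <= m%:R + 1.
  by rewrite natr1; apply/ltW; apply: truncnS_gt.
have B := @bernoulli_ge (x ^+ n) m.
have P : (1 - x ^+ n) ^+ m * (1 + x ^+ n) ^+ m <= 1.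
  rewrite -exprMn exprn_ile1//; first by nra.
  by nra.
have y0 : 0 <= (1 - x ^+ n) ^+ m by rewrite exprn_ge0// subr_ge0.
rewrite expr_div_n ler_pdivlMr//.
have Q : x ^+ n <= h ^+ n * (1 + x ^+ n) ^+ m.
  have B' : 1 + m%:R * x ^+ n <= (1 + x ^+ n) ^+ m by apply: B; lra.
  have : x ^+ n * h ^- n <= (1 + x ^+ n) ^+ m.
    by apply: le_trans B'; nra.
  by rewrite ler_pdivrMr// mulrC.
apply: (@le_trans _ _ ((1 - x ^+ n) ^+ m * (h ^+ n * (1 + x ^+ n) ^+ m))).
  exact: ler_wpM2l.
by rewrite mulrCA -[leRHS]mulr1; apply: ler_wpM2l => //; exact: ltW.
Qed.

Lemma step_poly_cvg x : 0 <= x <= 1 -> x != h ->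
  step_poly n x @[n --> \oo] --> (((h < x)%R)%:R : R).
Proof.
move=> x01; have /andP[x0 x1] := x01; rewrite neq_lt => /orP[xh|hx].
- rewrite ltNge (ltW xh) /=.
  apply: (@squeeze_cvgr _ _ _ _ (cst 0) (fun n => (x / h) ^+ n)).
  + by apply: nearW => n; have /andP[-> _] := step_poly_bound n x01; rewrite step_poly_lo.
  + exact: cvg_cst.
  + apply: cvg_expr; rewrite ger0_norm ?divr_ge0// ?ltW//.
    by rewrite ltr_pdivrMr// mul1r.
- rewrite hx /=.
  have -> : (1 : R) = 1 - 0 by rewrite subr0.
  under eq_cvg do rewrite -[step_poly _ _](subKr 1).
  apply: cvgB; first exact: cvg_cst.
  apply: (@squeeze_cvgr _ _ _ _ (cst 0) (fun n => (h / x) ^+ n)).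
  + apply: nearW => n; have /andP[_ P1] := step_poly_bound n x01.
    by rewrite subr_ge0 P1 step_poly_hi// x1 (lt_trans h0 hx).
  + exact: cvg_cst.
  + apply: cvg_expr; rewrite ger0_norm ?divr_ge0// ?ltW//.
    by rewrite ltr_pdivrMr ?mul1r//; exact: lt_trans hx.
Qed.

End StepApproximation.

(** * Density of trigonometric polynomials *)

Section Density.
Variable R : realType.
Local Notation mu := (@lebesgue_measure R).
Local Notation mR := (measurableTypeR R).
Implicit Types (f p q : R -> R[i]) (c : R[i]) (t : R) (h : R -> R).

Lemma sqnorm_fin_num f (e : R) : (sqnorm f < e%:E)%E -> sqnorm f \is a fin_num.
Proof. by move=> fe; rewrite ge0_fin_numE//; apply: lt_trans fe _; exact: ltry. Qed.

Definition trig_approx f := measurable_cfun f /\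
  forall e : R, 0 < e -> exists p, trigpoly p /\ (sqnorm (f - p)%R < e%:E)%E.

Lemma trigpoly_approx p : trigpoly p -> trig_approx p.
Proof.
move=> tp; split; first exact/sqi_measurable/trigpoly_sqi.
by move=> e e0; exists p; split => //; rewrite subrr sqnorm0 lte_fin.
Qed.

Lemma trig_approxZD c f g : trig_approx f -> trig_approx g -> trig_approx (c *: f + g).
Proof.
move=> [mf af] [mg ag]; split; first exact: measurable_cfunZD.
move=> e e0.
set K := Normc.normc c ^+ 2.
have K0 : 0 <= K by exact: sqr_ge0.
(* with K + 1 in place of K the division is safe when c = 0 *)
have [p [tp fp]] := af (e / (4 * (K + 1))) ltac:(rewrite divr_gt0//; lra).
have [q [tq gq]] := ag (e / 4) ltac:(lra).
exists (c *: p + q); split; first by apply: trigpolyD => //; exact: trigpolyZ.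
rewrite (_ : c *: f + g - _ = c *: (f - p) + (g - q)); last first.
  by rewrite scalerBr opprD addrACA.
have mp := sqi_measurable (trigpoly_sqi tp).
have mq := sqi_measurable (trigpoly_sqi tq).
apply: (le_lt_trans (sqnorm_ZD c (measurable_cfunB mf mp) (measurable_cfunB mg mq))).
have fp' : sqnorm (f - p) \is a fin_num by exact: (sqnorm_fin_num fp).
have gq' : sqnorm (g - q) \is a fin_num by exact: (sqnorm_fin_num gq).
move: fp gq; rewrite -(fineK fp') -(fineK gq') -!EFinM -EFinD !lte_fin.
rewrite -/K ltr_pdivlMr; last by lra.
have : 0 <= fine (sqnorm (f - p)) by exact: fine_ge0.
by nra.
Qed.

Lemma trig_approx_lim f : measurable_cfun f ->
  (forall e : R, 0 < e -> exists g, trig_approx g /\ (sqnorm (f - g)%R < e%:E)%E) ->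
  trig_approx f.
Proof.
move=> mf H; split => // e e0.
have [g [[mg ag] fg]] := H (e / 4) ltac:(lra).
have [p [tp gp]] := ag (e / 4) ltac:(lra).
exists p; split => //.
have mp := sqi_measurable (trigpoly_sqi tp).
apply: (le_lt_trans (sqnorm_split mf mp mg)); rewrite (sqnormBC p).
have fg' : sqnorm (f - g) \is a fin_num by exact: (sqnorm_fin_num fg).
have gp' : sqnorm (g - p) \is a fin_num by exact: (sqnorm_fin_num gp).
by move: fg gp; rewrite -(fineK fg') -(fineK gp') -!EFinM -EFinD !lte_fin; lra.
Qed.

(** Dominated convergence, phrased for the square norm: the closure of the trigonometric
polynomials contains dominated limits of its members. *)
Lemma trig_approx_dct f (g : nat -> R -> R[i]) (G : mR -> \bar R) :
  measurable_cfun f -> (forall n, trig_approx (g n)) ->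
  measurable_fun (@period R) G -> (forall t, 0 <= G t)%E ->
  (\int[mu]_(t in @period R) G t < +oo)%E ->
  (forall n t, @period R t -> (Normc.normc (f t - g n t) ^+ 2)%:E <= G t)%E ->
  {ae mu, forall t, @period R t ->
    (fun n => Normc.normc (f t - g n t) ^+ 2) @ \oo --> (0 : R)} ->
  trig_approx f.
Proof.
move=> mf ag mG G0 iG fG fg; apply: trig_approx_lim => // e e0.
have mfg n : measurable_cfun (f - g n).
  by apply: measurable_cfunB => //; have [] := ag n.
have [N HN] := sqnorm_cvg0P (sqnorm_cvg0 mfg mG G0 iG fG fg) e0.
by exists (g N); split => //; exact: HN.
Qed.

Lemma normc2_real (r : R) : Normc.normc r%:C ^+ 2 = r ^+ 2.
Proof. by rewrite normc2E /= expr0n addr0. Qed.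

Definition rapprox h := trig_approx (fun t => (h t)%:C).

Lemma measurable_rfun h : measurable_fun setT (h : mR -> mR) <->
  measurable_cfun (fun t => (h t)%:C).
Proof. by split => [mh|[]//]; split => //; exact: measurable_cst. Qed.

Lemma rapproxZD (a : R) h1 h2 : rapprox h1 -> rapprox h2 -> rapprox (fun t => a * h1 t + h2 t).
Proof.
move=> a1 a2; rewrite /rapprox (_ : (fun t => _) = a%:C *: (fun t => (h1 t)%:C) + (fun t =>
  (h2 t)%:C)).
  exact: trig_approxZD.
by apply/funext => t; rewrite !fctE rmorphD rmorphM.
Qed.

Lemma rapprox1 : rapprox (fun=> 1).
Proof. exact/trigpoly_approx/trigpoly1. Qed.

Lemma rapprox0 : rapprox (fun=> 0).
Proof. exact/trigpoly_approx/trigpoly0. Qed.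

Lemma rapprox_dct h (u : nat -> R -> R) (G : mR -> \bar R) :
  measurable_fun setT (h : mR -> mR) -> (forall n, rapprox (u n)) ->
  measurable_fun (@period R) G -> (forall t, 0 <= G t)%E ->
  (\int[mu]_(t in @period R) G t < +oo)%E ->
  (forall n t, @period R t -> ((h t - u n t) ^+ 2)%:E <= G t)%E ->
  {ae mu, forall t, @period R t -> u ^~ t @ \oo --> h t} ->
  rapprox h.
Proof.
move=> mh au mG G0 iG hG hu.
apply: (@trig_approx_dct _ (fun n t => (u n t)%:C) G) => //.
- exact/measurable_rfun.
- by move=> n t pt; rewrite -rmorphB normc2_real; exact: hG.
- move: hu; apply: lebesgue_aeS => t H pt.
  rewrite (_ : (fun n => _) = (fun n => (h t - u n t) * (h t - u n t))); last first.
    by apply/funext => n; rewrite -rmorphB normc2_real expr2.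
  have U : (fun n => h t - u n t) @ \oo --> (0 : R).
    by rewrite -(subrr (h t)); apply: cvgB; [exact: cvg_cst|exact: H].
  by rewrite -[X in _ --> X](mulr0 0); exact: (cvgM U U).
Qed.

Lemma integral_period_cst_lty (r : R) : (\int[mu]_(t in @period R) r%:E < +oo)%E.
Proof.
rewrite integral_cst//.
rewrite /period /= lebesgue_measure_itv /=; case: ifP => _; last by rewrite mule0 ltry.
by rewrite -EFinM ltry.
Qed.

Lemma rapprox_bounded_cvg h (u : nat -> R -> R) (M : R) :
  measurable_fun setT (h : mR -> mR) -> (forall n, rapprox (u n)) ->
  (forall n t, @period R t -> `|h t - u n t| <= M) ->
  {ae mu, forall t, @period R t -> u ^~ t @ \oo --> h t} ->
  rapprox h.
Proof.
move=> mh au bM hu.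
apply: (@rapprox_dct _ u (cst (M ^+ 2)%:E)) => //.
- by move=> t; rewrite lee_fin sqr_ge0.
- exact: integral_period_cst_lty.
- move=> n t pt; rewrite lee_fin -real_normK ?num_real//.
  by apply: lerXn2r; rewrite ?nnegrE// ?bM// (le_trans _ (bM n t pt)).
Qed.

Lemma rapprox_ae h (g : R -> R) : measurable_fun setT (h : mR -> mR) -> rapprox g ->
  {ae mu, forall t, @period R t -> g t = h t} -> (forall t, `|h t - g t| <= 1) -> rapprox h.
Proof.
move=> mh ag gh hg1; apply: (@rapprox_bounded_cvg _ (fun=> g) 1) => //.
by move: gh; apply: lebesgue_aeS => t H pt; rewrite (H pt); exact: cvg_cst.
Qed.

(** The sign of the left side tells whether t lies in the arc from 0 to b: for t and b
strictly between 0 and 2 pi, the first sine is positive and the second has the sign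
of b - t. *)
Lemma arc_cos (b t : R) :
  (1 + cos (t - b / 2)) / 2 - (1 + cos (b / 2)) / 2 = sin (t / 2) * sin ((b - t) / 2).
Proof.
have -> : t - b / 2 = t / 2 - (b - t) / 2 by lra.
have -> : cos (b / 2) = cos (t / 2 + (b - t) / 2) by congr cos; lra.
by rewrite cosB cosD; lra.
Qed.

(** For 0 < b < 2 pi the ray meets the period, up to endpoints, in the arc from 0 to b,
a superlevel set of cos (t - b/2) by [arc_cos]; hence [step_poly] applies. *)
Lemma rapprox_ray (b : R) : rapprox (\1_(`]-oo, b[%classic : set R)).
Proof.
have pi0 : 0 < (pi : R) := pi_gt0 R.
have mI : measurable_fun setT (\1_(`]-oo, b[%classic : set R) : mR -> mR).
  by apply: measurable_indic; exact: measurable_itv.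
have IE t : \1_(`]-oo, b[%classic : set R) t = ((t < b)%R)%:R :> R.
  by rewrite indicE mem_setE in_itv.
(* outside 0 < b < 2 pi the ray is empty or full on the period, up to one point *)
have [b0|b0] := leP b 0.
  apply: (rapprox_ae mI rapprox0) => [|t]; last first.
    by rewrite IE subr0; case: (t < b); rewrite ?normr1 ?normr0.
  apply: aeW => t; rewrite /period /= in_itv /= => /andP[t0 _].
  by rewrite IE ltNge (le_trans b0 t0).
have [b2|b2] := leP (2 * pi) b.
  apply: (rapprox_ae mI rapprox1) => [|t]; last first.
    by rewrite IE; case: (t < b); rewrite ?subrr ?sub0r ?normrN ?normr1 ?normr0.
  apply: (@lebesgue_ae_finite _ [:: 2 * pi]) => t; rewrite inE => t2.
  rewrite /period /= in_itv /= => /andP[_ t2'].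
  by rewrite IE (lt_le_trans _ b2)// lt_neqAle t2.
(* the affine map x |-> (1 + x) / 2 sends the values of cos into [0, 1] *)
set r := (1 + cos (b / 2)) / 2.
pose x t := (1 + cos (t - b / 2)) / 2.
have s0 : 0 < sin (b / 2) by apply: sin_gt0_pi; apply/andP; split; lra.
have cb : cos (b / 2) ^+ 2 < 1.
  have s2 : 0 < sin (b / 2) ^+ 2 by rewrite exprn_gt0.
  by have := cos2Dsin2 (b / 2); lra.
have r0 : 0 < r by rewrite /r; move: cb; rewrite expr2; nra.
have r1 : r < 1 by rewrite /r; move: cb; rewrite expr2; nra.
have x01 t : 0 <= x t <= 1.
  by have := cos_geN1 (t - b / 2); have := cos_le1 (t - b / 2); rewrite /x; move=> *;
    apply/andP; split; lra.
apply: (@rapprox_bounded_cvg _ (fun n t => step_poly r n (x t)) 1) => //.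
- move=> n; apply: trigpoly_approx; rewrite /step_poly.
  have tx : trigpoly (fun t => (x t)%:C).
    rewrite (_ : (fun t => _) = (2^-1)%:C *: ((fun=> 1) + (fun t => (cos (t - b / 2))%:C))).
      by apply: trigpolyZ; apply: trigpolyD; [exact: trigpoly1|exact: trigpoly_cos].
    by apply/funext => t; rewrite !fctE /x mulrC rmorphM rmorphD.
  rewrite (_ : (fun t => _) = (fun=> 1) - (fun t => ((fun=> 1) - (fun t => (x t)%:C ^+ n))
    t ^+ Num.truncn (r ^- n))).
    apply: trigpolyD; first exact: trigpoly1.
    apply/trigpolyN/trigpolyX/trigpolyD; first exact: trigpoly1.
    exact/trigpolyN/trigpolyX.
  by apply/funext => t; rewrite !fctE rmorphB rmorphXn rmorphB rmorphXn.
- move=> n t pt; have /andP[q0 q1] := step_poly_bound r n (x01 t).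
  by rewrite IE ler_norml; case: (t < b) => /=; apply/andP; split; lra.
- (* at 0, b and 2 pi the value x t is the threshold r, where [step_poly] need not converge *)
  apply: (@lebesgue_ae_finite _ [:: 0; b; 2 * pi]) => t.
  rewrite !inE !negb_or => /and3P[t0 tb t2].
  rewrite /period /= in_itv /= => /andP[t0' t2'].
  have {t0 t0'} t0 : 0 < t by rewrite lt_neqAle eq_sym t0.
  have {t2 t2'} t2 : t < 2 * pi by rewrite lt_neqAle t2.
  have st : 0 < sin (t / 2) by apply: sin_gt0_pi; apply/andP; split; lra.
  have E := arc_cos b t.
  have [xr tbE] : x t != r /\ (r < x t) = (t < b).
    have [lt_tb|lt_bt|/eqP] := ltgtP t b; last by rewrite (negbTE tb).
    - have sb : 0 < sin ((b - t) / 2) by apply: sin_gt0_pi; apply/andP; split; lra.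
      have rx : r < x t by rewrite -subr_gt0 E mulr_gt0.
      by rewrite rx gt_eqF.
    - have sb : 0 < sin ((t - b) / 2) by apply: sin_gt0_pi; apply/andP; split; lra.
      have sE : sin ((b - t) / 2) = - sin ((t - b) / 2) by rewrite -sinN; congr sin; lra.
      have rx : x t < r by rewrite -subr_lt0 E sE mulrN oppr_lt0 mulr_gt0.
      by rewrite lt_eqF// ltNge ltW.
  by rewrite IE -tbE; exact: step_poly_cvg.
Qed.

(** Pi-lambda theorem: rays are stable under intersection and generate the Borel sets,
and approximability of the indicator passes to proper differences by linearity and to
increasing unions by bounded convergence. *)
Lemma rapprox_indic (A : set mR) : measurable A -> rapprox (\1_A).
Proof.
move=> mA.
pose H := [set A : set mR | measurable A /\ rapprox (\1_A)].
suff : H A by case.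
have mE : (@measurable _ mR) = <<s @RGenInftyO.G R >>.
  exact: RGenInftyO.measurableE.
have : <<s [set: mR], @RGenInftyO.G R >> `<=` H; last first.
  by apply; move: mA; rewrite mE.
apply: lambda_system_subset => //.
- move=> _ _ [x ->] [y ->]; exists (Num.min x y).
  by apply/seteqP; split => t /=; rewrite !in_itv /= lt_min; [case=> -> ->|move=> /andP[-> ->]].
- split => //.
  + split; first exact: measurableT.
    by rewrite indicT; exact: rapprox1.
  + move=> B C CB [mB aB] [mC aC]; split; first exact: measurableD.
    rewrite (_ : \1__ = fun t => (-1) * \1_C t + \1_B t); first exact: rapproxZD.
    apply/funext => t; rewrite !indicE in_setD mulN1r.
    have [tC|tC] := boolP (t \in C); last by rewrite andbT oppr0 add0r.
    by rewrite (mem_set (CB _ (set_mem tC))) /= addNr.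
  + move=> F ndF HF; have mF n : measurable (F n) by have [] := HF n.
    have mU : measurable (\bigcup_i F i) by exact: bigcupT_measurable.
    split => //.
    apply: (@rapprox_bounded_cvg _ (fun n => \1_(F n)) 1).
    * exact: measurable_indic.
    * by move=> n; have [] := HF n.
    * move=> n t _; rewrite !indicE.
      by case: (_ \in _); case: (_ \in _);
        rewrite /= ?subrr ?subr0 ?sub0r ?normrN ?normr1 ?normr0.
    * apply: aeW => t _; rewrite indicE.
      have [|tU] := boolP (t \in _).
        rewrite inE => -[N _ FN]; apply: cvg_near_cst; exists N => // n /= Nn.
        by rewrite indicE mem_set//; move/subsetPset : (ndF _ _ Nn); exact.
      apply: cvg_near_cst; apply: nearW => n; rewrite indicE memNset//.
      by move=> Fn; move/negP: tU; apply; rewrite inE; exists n.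
- move=> _ [x ->]; split; last exact: rapprox_ray.
  exact: measurable_itv.
Qed.

Import HBNNSimple.

Lemma rapprox_nnsfun (s : {nnsfun mR >-> R}) : rapprox s.
Proof.
have H (I : Type) (l : seq I) (c : I -> R) (A : I -> set mR) :
    (forall i, measurable (A i)) -> rapprox (fun t => \sum_(i <- l) (c i * \1_(A i) t)).
  move=> mA; elim: l => [|i l IH].
    by under eq_fun do rewrite big_nil; exact: rapprox0.
  under eq_fun do rewrite big_cons.
  by apply: rapproxZD => //; exact: rapprox_indic.
rewrite (_ : (s : R -> R) = fun t => \sum_(y <- finmap.enum_fset (fset_set (range s)))
  (y * \1_(s @^-1` [set y]) t)).
  by apply: H => i; exact: measurable_funPTI.
by apply/funext => t; rewrite [LHS]fimfunE fsbig_finite.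
Qed.

Lemma rapprox_nneg h : measurable_fun setT (h : mR -> mR) -> (forall t, 0 <= h t) ->
  (\int[mu]_(t in @period R) (h t ^+ 2)%:E < +oo)%E -> rapprox h.
Proof.
move=> mh h0 ih.
have mEh : measurable_fun setT (fun t : mR => (h t)%:E) by exact/measurable_EFinP.
pose s := nnsfun_approx measurableT mEh.
have sh t : (fun n => s n t) @ \oo --> h t.
  have := @cvg_nnsfun_approx _ _ _ _ measurableT _ mEh (fun x _ => h0 x) t I.
  by move/fine_cvg.
have s_le n t : s n t <= h t.
  have /cvg_lim <- // := sh t; apply: nondecreasing_cvgn_le;
    last by apply/cvg_ex; exists (h t); exact: sh.
  by move=> m k mk; have /lefP := nd_nnsfun_approx measurableT mEh mk; apply.
apply: (@rapprox_dct _ (fun n => s n) (fun t => (h t ^+ 2)%:E)) => //.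
- by move=> n; exact: rapprox_nnsfun.
- by apply/measurable_EFinP; apply: measurable_funTS; exact: measurable_funX.
- by move=> t; rewrite lee_fin sqr_ge0.
- move=> n t _; rewrite lee_fin lerXn2r ?nnegrE ?subr_ge0 ?s_le//.
  by rewrite gerBl.
- by apply: aeW => t _; exact: sh.
Qed.

Lemma rapprox_real h : measurable_fun setT (h : mR -> mR) ->
  (\int[mu]_(t in @period R) (h t ^+ 2)%:E < +oo)%E -> rapprox h.
Proof.
move=> mh ih.
have mp (g : R -> R) : measurable_fun setT (g : mR -> mR) ->
    measurable_fun setT (fun t : mR => Num.max (g t) 0).
  by move=> mg; apply: measurable_maxr => //; exact: measurable_cst.
have K (g : R -> R) : measurable_fun setT (g : mR -> mR) -> (forall t, g t ^+ 2 = h t ^+ 2) ->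
    rapprox (fun t => Num.max (g t) 0).
  move=> mg gh; apply: rapprox_nneg; first exact: mp.
    by move=> t; rewrite le_max lexx orbT.
  apply: le_lt_trans ih; apply: ge0_le_integral => //=.
  - by move=> t _; rewrite lee_fin sqr_ge0.
  - by apply/measurable_EFinP; apply: measurable_funTS; apply: measurable_funX; exact: mp.
  - by apply/measurable_EFinP; apply: measurable_funTS; exact: measurable_funX.
  - move=> t _; rewrite lee_fin -gh; case: (leP (g t) 0) => // g0.
    by rewrite expr0n sqr_ge0.
rewrite (_ : h = fun t => -1 * Num.max (- h t) 0 + Num.max (h t) 0).
  by apply: rapproxZD; apply: K => // [|t]; [exact: measurable_funN|rewrite sqrrN].
by apply/funext => t; case: (leP (h t) 0) => h0; case: (leP (- h t) 0) => h0'; lra.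
Qed.

(** Real and imaginary parts reduce this to real functions, positive and negative parts to
nonnegative ones, and these are dominated limits of simple functions. *)
Theorem trigpoly_dense f : measurable_cfun f -> (sqnorm f < +oo)%E ->
  forall e : R, 0 < e -> exists p, trigpoly p /\ (sqnorm (f - p)%R < e%:E)%E.
Proof.
move=> mf nf; suff [] : trig_approx f by [].
have [mr mi] := mf.
have part (h : R -> R) : measurable_fun setT (h : mR -> mR) ->
    (forall t, h t ^+ 2 <= Normc.normc (f t) ^+ 2) -> rapprox h.
  move=> mh hf; apply: rapprox_real => //.
  apply: le_lt_trans nf; apply: ge0_le_integral => //=.
  - by move=> t _; rewrite lee_fin sqr_ge0.
  - by apply/measurable_EFinP; apply: measurable_funTS; exact: measurable_funX.
  - exact: measurable_EFin_normc2.
  - by move=> t _; rewrite lee_fin; exact: hf.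
rewrite (_ : f = (0 +i* 1) *: (fun t => (complex.Im (f t))%:C) +
    (fun t => (complex.Re (f t))%:C)).
  apply: trig_approxZD; apply: part => // t; rewrite normc2E.
  - by rewrite lerDr sqr_ge0.
  - by rewrite lerDl sqr_ge0.
apply/funext => t; rewrite !fctE; case: (f t) => x y /=.
by apply/eqP; rewrite eq_complex /=; apply/andP; split; apply/eqP;
  rewrite ?mul0r ?mul1r ?mulr0; ring.
Qed.

End Density.

(** * Series with geometrically decaying coefficients *)

Section WeightedCauchySchwarz.
Variable R : realFieldType.

(** By induction: writing A, W, B for the three sums, the cross term 2 A y is at most
W y^2 + B because (W y^2 + B)^2 >= 4 W B y^2 >= 4 A^2 y^2. *)
Lemma weighted_cauchy_schwarz (w x : nat -> R) n : (forall l, 0 <= w l) ->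
  (\sum_(l < n) w l * x l) ^+ 2 <=
  (\sum_(l < n) w l) * (\sum_(l < n) w l * x l ^+ 2).
Proof.
move=> w0; elim: n => [|n IH]; first by rewrite !big_ord0 expr0n mul0r.
rewrite !big_ord_recr /=.
have W0 : 0 <= \sum_(l < n) w l by apply: sumr_ge0.
have B0 : 0 <= \sum_(l < n) w l * x l ^+ 2.
  by apply: sumr_ge0 => l _; rewrite mulr_ge0// sqr_ge0.
move: IH W0 B0; set A := \sum_(l < n) w l * x l; set W := \sum_(l < n) w l.
set B := \sum_(l < n) _ => IH W0 B0.
have wn := w0 n; set v := w n in wn *; set y := x n.
have key : 2 * A * y <= W * y ^+ 2 + B.
  have y0 := sqr_ge0 y; have P0 : 0 <= W * y ^+ 2 + B by rewrite addr_ge0// mulr_ge0.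
  rewrite (le_trans (ler_norm _))// -(@ler_pXn2r _ 2)// ?nnegrE//.
  rewrite real_normK ?num_real//.
  have -> : (W * y ^+ 2 + B) ^+ 2 = 4 * (W * B) * y ^+ 2 + (W * y ^+ 2 - B) ^+ 2 by ring.
  have -> : (2 * A * y) ^+ 2 = 4 * A ^+ 2 * y ^+ 2 by ring.
  rewrite -[leLHS]addr0 lerD ?sqr_ge0//.
  by rewrite ler_wpM2r// ler_wpM2l.
have : v * (2 * A * y) <= v * (W * y ^+ 2 + B) by exact: ler_wpM2l.
have -> : (A + v * y) ^+ 2 = A ^+ 2 + v * (2 * A * y) + v ^+ 2 * y ^+ 2 by ring.
have -> : (W + v) * (B + v * y ^+ 2) = W * B + v * (W * y ^+ 2 + B) + v ^+ 2 * y ^+ 2 by ring.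
by move=> H; rewrite lerD2r lerD.
Qed.

End WeightedCauchySchwarz.

Section GeometricSeries.
Variable R : realType.
Local Notation mu := (@lebesgue_measure R).
Local Notation mR := (measurableTypeR R).

Lemma le_normc_sum (I : Type) (s : seq I) (F : I -> R[i]) :
  Normc.normc (\sum_(i <- s) F i) <= \sum_(i <- s) Normc.normc (F i).
Proof.
elim: s => [|i s IH]; first by rewrite !big_nil Normc.normc0.
by rewrite !big_cons (le_trans (le_normcD _ _))// lerD2l.
Qed.

Lemma normc2D_le (z w : R[i]) : Normc.normc (z + w) ^+ 2 <=
  2 * Normc.normc z ^+ 2 + 2 * Normc.normc w ^+ 2.
Proof. by have := normc2_ZD 1 z w; rewrite mul1r Normc.normc1 expr1n mulr1. Qed.

Lemma normc2N (z : R[i]) : Normc.normc (- z) ^+ 2 = Normc.normc z ^+ 2.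
Proof. by rewrite !normc2E; case: z => x y /=; rewrite !sqrrN. Qed.

Lemma normc_ge0 (z : R[i]) : 0 <= Normc.normc z.
Proof. by case: z => x y; exact: sqrtr_ge0. Qed.

Lemma normr_Re_le (z : R[i]) : `|complex.Re z| <= Normc.normc z.
Proof.
rewrite -(@ler_pXn2r _ 2)// ?nnegrE ?normc_ge0//.
by rewrite real_normK ?num_real// normc2E lerDl sqr_ge0.
Qed.

Lemma normr_Im_le (z : R[i]) : `|complex.Im z| <= Normc.normc z.
Proof.
rewrite -(@ler_pXn2r _ 2)// ?nnegrE ?normc_ge0//.
by rewrite real_normK ?num_real// normc2E lerDr sqr_ge0.
Qed.

Variables (f : nat -> R -> R[i]) (c : nat -> R) (C r K : R).
Hypotheses (C0 : 0 < C) (r0 : 0 < r) (r1 : r < 1) (K0 : 0 <= K).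
Hypothesis c_le : forall l, `|c l| <= C * r ^+ l.
Hypothesis sf : forall l, f l \in @square_integrable R.
Hypothesis nf : forall l, (sqnorm (f l) <= K%:E)%E.

Let S n : R -> R[i] := \sum_(l < n) (c l)%:C *: f l.
Let g l t : R := r ^+ l * Normc.normc (f l t) ^+ 2.
Let G (t : mR) : \bar R := (\sum_(l <oo) (g l t)%:E)%E.
Let L : R := (1 - r)^-1.

Let L0 : 0 < L. Proof. by rewrite invr_gt0 subr_gt0. Qed.

Let g0 l t : 0 <= g l t.
Proof. by rewrite mulr_ge0// ?sqr_ge0// exprn_ge0// ltW. Qed.

Let G0 t : (0 <= G t)%E.
Proof. by apply: nneseries_ge0 => l _ _; rewrite lee_fin. Qed.

Let mg l : measurable_fun setT (g l : mR -> mR).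
Proof.
apply: measurable_funM; first exact: measurable_cst.
by apply: measurable_normc2; exact: sqi_measurable.
Qed.

Let mG : measurable_fun setT G.
Proof.
apply: (@ge0_emeasurable_sum _ _ _ setT (fun l t => (g l t)%:E) xpredT).
- by move=> l t _ _; rewrite lee_fin.
- by move=> l _; apply/measurable_EFinP; exact: mg.
Qed.

Let sum_geo n : \sum_(l < n) r ^+ l <= L.
Proof.
have := @geometric_le_lim _ n 1 r ler01 r0; rewrite ger0_norm; last exact: ltW.
move/(_ r1).
rewrite mul1r /series /= big_mkord; apply: le_trans.
by apply: ler_sum => l _; rewrite /geometric /= mul1r.
Qed.

Let iG : (\int[mu]_(t in @period R) G t < +oo)%E.
Proof.
rewrite integral_nneseries//; first last.
- by move=> l t _; rewrite lee_fin.
- by move=> l; apply: measurable_funTS; apply/measurable_EFinP; exact: mg.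
apply: (@le_lt_trans _ _ (L * K)%:E); last exact: ltry.
apply: lime_le.
  by apply: is_cvg_nneseries => l _ _; apply: integral_ge0 => t _; rewrite lee_fin.
apply: nearW => n.
apply: (@le_trans _ _ (\sum_(0 <= l < n) (r ^+ l * K)%:E)%E).
  apply: lee_sum => l _.
  rewrite (_ : \int[mu]_(t in _) _ = (r ^+ l)%:E * sqnorm (f l))%E.
    by rewrite EFinM lee_wpmul2l// lee_fin exprn_ge0// ltW.
  rewrite /sqnorm -ge0_integralZl//.
  - by apply: measurable_EFin_normc2; exact: sqi_measurable.
  - by move=> t _; rewrite lee_fin.
  - by rewrite lee_fin exprn_ge0// ltW.
rewrite sumEFin lee_fin -mulr_suml big_mkord.
by apply: ler_wpM2r.
Qed.

Let partial_le n t : (G t < +oo)%E -> \sum_(l < n) g l t <= fine (G t).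
Proof.
move=> Gt; rewrite -lee_fin fineK; last by rewrite ge0_fin_numE.
rewrite -sumEFin -(big_mkord xpredT (fun l => (g l t)%:E)).
by apply: nneseries_lim_ge => l _ _; rewrite lee_fin.
Qed.

Let abs_le n t : (G t < +oo)%E ->
  \sum_(l < n) Normc.normc ((c l)%:C * f l t) <= C * (L + fine (G t)).
Proof.
move=> Gt.
apply: (@le_trans _ _ (C * (\sum_(l < n) r ^+ l + \sum_(l < n) g l t))); last first.
  by apply: ler_wpM2l; [exact: ltW|apply: lerD => //; exact: partial_le].
rewrite -big_split mulr_sumr; apply: ler_sum => l _.
rewrite Normc.normcM /g /=.
have rl : 0 <= r ^+ l by rewrite exprn_ge0// ltW.
have := c_le l; rewrite expr0n addr0 sqrtr_sqr => cl.
have N0 := normc_ge0 (f l t).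
apply: (@le_trans _ _ (C * r ^+ l * Normc.normc (f l t))); first exact: ler_wpM2r.
rewrite -mulrA; apply: ler_wpM2l; first exact: ltW.
rewrite -[X in X + _]mulr1 -mulrDr; apply: ler_wpM2l => //.
by rewrite expr2; nra.
Qed.

Let cvg_part (h : R[i] -> R) t : (forall z, `|h z| <= Normc.normc z) ->
  (forall n (F : nat -> R[i]), h (\sum_(l < n) F l) = \sum_(l < n) h (F l)) ->
  (G t < +oo)%E -> cvgn (fun n => h (S n t)).
Proof.
move=> hle hadd Gt.
pose u l := h ((c l)%:C * f l t).
have -> : (fun n => h (S n t)) = series u.
  apply/funext => n; transitivity (h (\sum_(l < n) (c l)%:C * f l t)).
    by rewrite /S fct_sumE.
  by rewrite (hadd n (fun l => (c l)%:C * f l t)) /series /= big_mkord.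
apply: normed_cvg; apply: nondecreasing_is_cvgn.
  by apply: nondecreasing_series => l _ _; exact: normr_ge0.
exists (C * (L + fine (G t))) => _ [n _ <-].
rewrite -[leLHS]/(\sum_(0 <= l < n) `|u l|) big_mkord; apply: le_trans (abs_le n Gt).
by apply: ler_sum => l _; exact: hle.
Qed.

Let cvg_Re t : (G t < +oo)%E -> cvgn (fun n => complex.Re (S n t)).
Proof.
apply: cvg_part; first exact: normr_Re_le.
by move=> n F; rewrite (big_morph (@complex.Re R) (id1 := 0) (op1 := +%R))// => -[? ?] [? ?].
Qed.

Let cvg_Im t : (G t < +oo)%E -> cvgn (fun n => complex.Im (S n t)).
Proof.
apply: cvg_part; first exact: normr_Im_le.
by move=> n F; rewrite (big_morph (@complex.Im R) (id1 := 0) (op1 := +%R))// => -[? ?] [? ?].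
Qed.

Let z t : R[i] := if (G t < +oo)%E then
  limn (fun n => complex.Re (S n t)) +i* limn (fun n => complex.Im (S n t)) else 0.

Let sS n : S n \in @square_integrable R.
Proof.
rewrite /S; elim/big_ind: _ => //; [exact: sqi0|exact: sqiD|].
by move=> l _; exact: sqiZ.
Qed.

Let mE : measurable [set t : mR | (G t < +oo)%E].
Proof.
have := mG measurableT (emeasurable_itv (Interval -oo%O (BLeft +oo%E))); rewrite setTI.
by congr measurable; apply/seteqP; split => t /=; rewrite in_itv.
Qed.

Let mz : measurable_cfun z.
Proof.
have K1 (h : R[i] -> R) : h 0 = 0 -> (forall n, measurable_fun setT (h \o S n)) ->
    (forall t, (G t < +oo)%E -> (fun n => h (S n t)) @ \oo --> h (z t)) ->
    measurable_fun setT (h \o z).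
  move=> h00 mh hz.
  apply: (@measurable_fun_cvg _ _ _ setT
    (fun n t => \1_[set t : mR | (G t < +oo)%E] t * h (S n t))).
    by move=> n; apply: measurable_funM; [exact: measurable_indic|exact: mh].
  move=> t _; rewrite indicE.
  case: (boolP ((G t < +oo)%E)) => Gt.
    by rewrite mem_set//; under eq_cvg do rewrite mul1r; exact: hz.
  rewrite memNset; last by apply/negP.
  by under eq_cvg do rewrite mul0r; rewrite /= /z (negbTE Gt) h00; exact: cvg_cst.
split; apply: K1 => //.
- by move=> n; have [] := sqi_measurable (sS n).
- by move=> t Gt; rewrite /z Gt; exact: cvg_Re.
- by move=> n; have [] := sqi_measurable (sS n).
- by move=> t Gt; rewrite /z Gt; exact: cvg_Im.
Qed.

Let cvg_normc2 (u : nat -> R[i]) (v : R[i]) :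
  (fun n => complex.Re (u n)) @ \oo --> complex.Re v ->
  (fun n => complex.Im (u n)) @ \oo --> complex.Im v ->
  (fun n => Normc.normc (u n) ^+ 2) @ \oo --> Normc.normc v ^+ 2.
Proof.
move=> ur ui; under eq_fun do rewrite normc2E; rewrite normc2E !expr2.
by apply: cvgD; apply: cvgM.
Qed.

Let S_le n t : (G t < +oo)%E -> Normc.normc (S n t) ^+ 2 <= C ^+ 2 * L * fine (G t).
Proof.
move=> Gt.
apply: (@le_trans _ _ ((\sum_(l < n) (C * r ^+ l) * Normc.normc (f l t)) ^+ 2)).
  have le1 : Normc.normc (S n t) <= \sum_(l < n) (C * r ^+ l) * Normc.normc (f l t).
    rewrite /S fct_sumE (le_trans (le_normc_sum _ _))//; apply: ler_sum => l _.
    rewrite !fctE Normc.normcM /= expr0n addr0 sqrtr_sqr.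
    by apply: ler_wpM2r; rewrite ?normc_ge0.
  by rewrite lerXn2r ?nnegrE ?normc_ge0// (le_trans _ le1) ?normc_ge0.
under eq_bigr do rewrite -mulrA.
rewrite -mulr_sumr exprMn -mulrA; apply: ler_wpM2l; first exact: sqr_ge0.
apply: le_trans (@weighted_cauchy_schwarz _ (fun l => r ^+ l)
  (fun l => Normc.normc (f l t)) n (fun l => exprn_ge0 l (ltW r0))) _.
apply: ler_pM => //.
- by apply: sumr_ge0 => l _; rewrite exprn_ge0// ltW.
- by apply: sumr_ge0 => l _; exact: g0.
- exact: partial_le.
Qed.

Let cvg_S t : (G t < +oo)%E ->
  (fun n => Normc.normc (S n t - z t) ^+ 2) @ \oo --> (0 : R).
Proof.
move=> Gt.
have -> : (0 : R) = Normc.normc (0 : R[i]) ^+ 2 by rewrite Normc.normc0 expr0n.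
apply: cvg_normc2; rewrite raddf0.
- under eq_fun do rewrite raddfB; rewrite -(subrr (complex.Re (z t))).
  by apply: cvgB; [rewrite /z Gt; exact: cvg_Re|exact: cvg_cst].
- under eq_fun do rewrite raddfB; rewrite -(subrr (complex.Im (z t))).
  by apply: cvgB; [rewrite /z Gt; exact: cvg_Im|exact: cvg_cst].
Qed.

Let z_le t : (G t < +oo)%E -> Normc.normc (z t) ^+ 2 <= C ^+ 2 * L * fine (G t).
Proof.
move=> Gt.
have H : (fun n => Normc.normc (S n t) ^+ 2) @ \oo --> Normc.normc (z t) ^+ 2.
  by apply: cvg_normc2; rewrite /z Gt; [exact: cvg_Re|exact: cvg_Im].
have /cvg_lim <- // := H; apply: limr_le; first by apply/cvg_ex; eexists; exact: H.
by apply: nearW => n; exact: S_le.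
Qed.

(** The function G = sum r^l |f_l|^2 is integrable, hence finite almost everywhere; where
it is finite the series converges absolutely, and by the weighted Cauchy-Schwarz
inequality its partial sums are bounded by a multiple of the square root of G.
Dominated convergence turns pointwise into L^2 convergence.  The pointwise sum is set
to 0 where G is infinite, which keeps it measurable and periodic. *)
Lemma geometric_series_sqnorm_cvg : exists z, z \in @square_integrable R /\
  (fun n => sqnorm (\sum_(l < n) (c l)%:C *: f l - z)) @ \oo --> 0%E.
Proof.
have cv : (fun n => sqnorm (S n - z)) @ \oo --> 0%E.
  (* |S n - z|^2 <= 2 |S n|^2 + 2 |z|^2, each square being at most C^2 L G *)
  apply: (@sqnorm_cvg0 _ _ (fun t => (4 * (C ^+ 2 * L))%:E * G t)%E).
  - by move=> n; apply: measurable_cfunB => //; exact: sqi_measurable.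
  - by apply: measurable_funTS; exact: measurable_funeM.
  - by move=> t; rewrite mule_ge0// lee_fin mulr_ge0// mulr_ge0 ?sqr_ge0// ltW.
  - rewrite ge0_integralZl//.
    + rewrite lte_mul_pinfty// lee_fin mulr_ge0// mulr_ge0 ?sqr_ge0// ltW//.
    + exact: measurable_funTS.
    + by rewrite lee_fin mulr_ge0// mulr_ge0 ?sqr_ge0// ltW.
  - move=> n t _; have [Gt|] := boolP ((G t < +oo)%E); last first.
      rewrite -leNgt leye_eq => /eqP ->; rewrite gt0_muley ?leey//.
      by rewrite lte_fin mulr_gt0// mulr_gt0// exprn_gt0.
    rewrite -[G t]fineK; last by rewrite ge0_fin_numE.
    rewrite -EFinM lee_fin.
    have := normc2D_le (S n t) (- z t); rewrite normc2N.
    have := S_le n Gt; have := z_le Gt; rewrite -!mulrA.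
    by rewrite [(S n - z) t]/(S n t - z t); lra.
  - have : {ae mu, forall t, @period R t -> G t \is a fin_num}.
      apply: integrable_ae => //; apply/integrableP; split; first exact: measurable_funTS.
      by under eq_integral do rewrite gee0_abs//.
    apply: lebesgue_aeS => t Gt pt; apply: cvg_S.
    by rewrite -ge0_fin_numE//; exact: Gt.
exists z; split => //; apply/sqiP; split => //.
- move=> t.
  have GE : G (t + 2 * pi) = G t.
    by apply: eq_eseriesr => l _; rewrite /g (sqi_periodic (sf l)).
  have SE n : S n (t + 2 * pi) = S n t by rewrite (sqi_periodic (sS n)).
  rewrite /z GE; case: ifP => // _; congr (_ +i* _); congr (limn _); apply/funext => n;
    by rewrite SE.
- have [N /(_ _ (leqnn N)) HN] := sqnorm_cvg0P cv ltr01.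
  have mS := sqi_measurable (sS N).
  have -> : z = S N - (S N - z) by rewrite opprB addrC subrK.
  apply: le_lt_trans (sqnormD mS _) _; first by apply/measurable_cfunN/measurable_cfunB.
  rewrite sqnormN lte_add_pinfty// lte_mul_pinfty//; first exact: sqi_fin.
  by apply: lt_trans HN _; exact: ltry.
Qed.

End GeometricSeries.

(** * The operator R is the inverse of T *)

Section NeumannSeries.
Variable R : realType.
Implicit Types (f g h : R -> R[i]) (y : L2 R).

Lemma sqnorm_cvg_uniq (u : nat -> R -> R[i]) f g :
  (forall n, measurable_cfun (u n)) -> measurable_cfun f -> measurable_cfun g ->
  (fun n => sqnorm (u n - f)) @ \oo --> 0%E ->
  (fun n => sqnorm (u n - g)) @ \oo --> 0%E -> sqnorm (f - g) = 0%E.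
Proof.
move=> mu mf mg uf ug; apply/eqP; rewrite eq_le sqnorm_ge0 andbT.
apply/lee_addgt0Pr => e e0; rewrite add0e.
have [N1 H1] := sqnorm_cvg0P uf (divr_gt0 e0 (ltr0n R 4)).
have [N2 H2] := sqnorm_cvg0P ug (divr_gt0 e0 (ltr0n R 4)).
have {}H1 := H1 (maxn N1 N2) (leq_maxl _ _); have {}H2 := H2 (maxn N1 N2) (leq_maxr _ _).
move: (maxn N1 N2) H1 H2 => n H1 H2.
apply: (le_trans (sqnorm_split mf mg (mu n))); rewrite (sqnormBC f) (sqnormBC g).
have F1 := sqnorm_fin_num H1; have F2 := sqnorm_fin_num H2.
by move: H1 H2; rewrite -(fineK F1) -(fineK F2) -!EFinM -EFinD !lte_fin lee_fin; lra.
Qed.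

Lemma sqnorm_cvg0_le (u : nat -> \bar R) (v : nat -> \bar R) (k : R) :
  (forall n, (0 <= u n)%E) -> (forall n, (u n <= k%:E * v n)%E) ->
  v @ \oo --> 0%E -> u @ \oo --> 0%E.
Proof.
move=> u0 uv v0; apply: (@squeeze_cvge _ _ _ _ (cst 0%E) _ (fun n => k%:E * v n)%E).
- by apply: nearW => n; rewrite u0 uv.
- exact: cvg_cst.
- by rewrite -[X in _ --> X](mule0 k%:E); apply: cvgeZl.
Qed.

Lemma sqnorm_congr f g h : measurable_cfun f -> measurable_cfun g -> measurable_cfun h ->
  sqnorm (g - h) = 0%E -> sqnorm (f - g) = sqnorm (f - h).
Proof.
move=> mf mg mh /(sqnorm_eq0P (measurable_cfunB mg mh)) gh.
apply: ae_eq_sqnorm; try exact: measurable_cfunB.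
move: gh; apply: lebesgue_aeS => t gh pt; have := gh pt.
by rewrite !fctE => /eqP; rewrite subr_eq0 => /eqP ->.
Qed.

Lemma dil_lin l (k : R[i]) f g : dil l (k *: f + g) = k *: dil l f + dil l g.
Proof. by []. Qed.

Lemma dil_dil l m f : dil l (dil m f) = dil (l + m) f.
Proof. by apply/funext => t; rewrite /dil; congr f; rewrite !exprD; ring. Qed.

Variable a : R.

(** The operator T, as a combination of powers of the dilation; [TfE] gives the formula
in terms of values. *)
Definition Tf f : R -> R[i] := - a%:C *: dil 2 f + ((2 * a)%:C *: dil 1 f + f).

Lemma TfE f t : Tf f t = f t + 2 * a%:C * f (- 2 * t) - a%:C * f (4 * t).
Proof.
rewrite /Tf /dil !fctE rmorphM rmorph_nat /GRing.scale /= expr1 expr1 expr2.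
rewrite (_ : (-1) ^+ 2 * (2 * 2) * t = 4 * t); last by ring.
by rewrite mulN1r; ring.
Qed.

Lemma Tf_lin (k : R[i]) f g : Tf (k *: f + g) = k *: Tf f + Tf g.
Proof.
by apply/funext => t; rewrite /Tf /dil !fctE /GRing.scale /=; ring.
Qed.

Lemma sqi_Tf f : f \in @square_integrable R -> Tf f \in @square_integrable R.
Proof.
by move=> sf; rewrite /Tf; apply: sqiZD; [exact: sqi_dil|apply: sqiZD => //; exact: sqi_dil].
Qed.

Lemma normc2_realN (r : R) : Normc.normc (- r%:C) ^+ 2 = r ^+ 2.
Proof. by rewrite -rmorphN normc2_real sqrrN. Qed.

(** The constant is 2 a^2 + 2 (2 (2 a)^2 + 2), from two uses of [sqnorm_ZD]. *)
Lemma sqnorm_Tf f : f \in @square_integrable R ->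
  (sqnorm (Tf f) <= (18 * a ^+ 2 + 4)%:E * sqnorm f)%E.
Proof.
move=> sf; have m1 := sqi_measurable (sqi_dil 1 sf); have m2 := sqi_measurable (sqi_dil 2 sf).
have mf := sqi_measurable sf.
apply: (le_trans (sqnorm_ZD _ m2 (measurable_cfunZD _ m1 mf))).
have := sqnorm_ZD (2 * a)%:C m1 mf; rewrite normc2_realN normc2_real !sqnorm_dil//.
have F : sqnorm f \is a fin_num by rewrite ge0_fin_numE//; exact: sqi_fin.
have F' : sqnorm ((2 * a)%:C *: dil 1 f + f) \is a fin_num.
  by rewrite ge0_fin_numE//; apply: sqi_fin; apply: sqiZD => //; exact: sqi_dil.
rewrite -(fineK F) -(fineK F') -!EFinM -!EFinD !lee_fin => H.
by move: H; rewrite exprMn; lra.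
Qed.

Lemma Rpartial_dil f n : Rpartial a f n = \sum_(l < n) (Rcoef a l)%:C *: dil l f.
Proof. by apply/funext => t; rewrite /Rpartial fct_sumE. Qed.

Lemma RpartialS f n : Rpartial a f n.+1 = Rpartial a f n + (Rcoef a n)%:C *: dil n f.
Proof. by rewrite !Rpartial_dil big_ord_recr. Qed.

Lemma Rpartial_lin n (k : R[i]) f g :
  Rpartial a (k *: f + g) n = k *: Rpartial a f n + Rpartial a g n.
Proof.
elim: n => [|n IH].
  by apply/funext => t; rewrite /Rpartial !fctE !big_ord0 scaler0 addr0.
rewrite !RpartialS IH dil_lin.
by apply/funext => t; rewrite !fctE /GRing.scale /=; ring.
Qed.

Lemma sqi_Rpartial n f : f \in @square_integrable R -> Rpartial a f n \in @square_integrable R.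
Proof.
move=> sf; elim: n => [|n IH].
  by rewrite (_ : Rpartial a f 0 = 0) ?sqi0//; apply/funext => t; rewrite /Rpartial big_ord0.
by rewrite RpartialS addrC; apply: sqiZD => //; exact: sqi_dil.
Qed.

Lemma sqnorm_Rpartial0 n f : f \in @square_integrable R ->
  sqnorm f = 0%E -> sqnorm (Rpartial a f n) = 0%E.
Proof.
move=> sf f0; elim: n => [|n IH].
  by rewrite (_ : Rpartial a f 0 = 0) ?sqnorm0//; apply/funext => t; rewrite /Rpartial big_ord0.
apply/eqP; rewrite eq_le sqnorm_ge0 andbT RpartialS addrC.
apply: (le_trans (sqnorm_ZD _ _ _)); last by rewrite sqnorm_dil// f0 IH !mule0 adde0.
- by apply: sqi_measurable; exact: sqi_dil.
- by apply: sqi_measurable; exact: sqi_Rpartial.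
Qed.

Lemma Tf_Rpartial f n : Tf (Rpartial a f n) = Rpartial a (Tf f) n.
Proof.
elim: n => [|n IH].
  apply/funext => t; rewrite /Tf /dil /Rpartial !fctE !big_ord0.
  by rewrite !scaler0 !addr0.
rewrite !RpartialS -IH addrC Tf_lin addrC; congr (_ + _ *: _).
by rewrite /Tf !dil_dil dil_lin dil_lin !dil_dil !(addnC n).
Qed.

Hypotheses (a0 : 0 < a) (a3 : a < 3^-1).

Let s := Num.sqrt (a ^+ 2 + a).

Let s0 : 0 < s.
Proof. by rewrite sqrtr_gt0 addr_gt0// exprn_gt0. Qed.

Let s2 : s ^+ 2 = a ^+ 2 + a.
Proof. by rewrite sqr_sqrtr// addr_ge0 ?sqr_ge0// ltW. Qed.

Lemma Rcoef0 : Rcoef a 0 = 1.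
Proof. by rewrite /Rcoef -/s !expr1 expr0; field; rewrite gt_eqF. Qed.

Lemma Rcoef1 : Rcoef a 1 = - 2 * a.
Proof. by rewrite /Rcoef -/s expr1; field; rewrite gt_eqF. Qed.

(** The numbers -(a + s) and -(a - s) are the roots of x^2 = - 2 a x + a, which is the
recurrence satisfied by the coefficients of the inverse of 1 + 2 a X - a X^2. *)
Lemma RcoefSS l : Rcoef a l.+2 = - 2 * a * Rcoef a l.+1 + a * Rcoef a l.
Proof.
rewrite /Rcoef -/s.
have p : (a + s) ^+ 2 = 2 * a * (a + s) + a.
  by rewrite sqrrD s2; ring.
have m : (a - s) ^+ 2 = 2 * a * (a - s) + a.
  by rewrite sqrrB s2; ring.
have E (x : R) : x ^+ 2 = 2 * a * x + a -> x ^+ l.+3 = 2 * a * x ^+ l.+2 + a * x ^+ l.+1.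
  by move=> x2; rewrite (_ : l.+3 = 2 + l.+1)%N// exprD x2 (exprS _ l.+1); ring.
rewrite (E _ p) (E _ m) !(exprS (-1)).
move: (a + s) (a - s) => u v.
by field; rewrite gt_eqF.
Qed.

(** The larger of |a + s| and |a - s|. *)
Definition Rcoef_ratio : R := a + s.

Lemma Rcoef_ratio_gt0 : 0 < Rcoef_ratio. Proof. exact: addr_gt0. Qed.

(** Since s < 1 - a amounts to a^2 + a < 1 - 2 a + a^2, that is a < 1/3. *)
Lemma Rcoef_ratio_lt1 : Rcoef_ratio < 1.
Proof.
rewrite /Rcoef_ratio -ltrBrDl -(@ltr_pXn2r _ 2)// ?nnegrE ?ltW//; last by have := a3; lra.
by rewrite s2 (_ : (1 - a) ^+ 2 = 1 - 2 * a + a ^+ 2); [have := a3; lra|ring].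
Qed.

Lemma Rcoef_le l : `|Rcoef a l| <= Rcoef_ratio / s * Rcoef_ratio ^+ l.
Proof.
rewrite /Rcoef -/s normrM normrX normrN1 expr1n mul1r normrM.
have -> : `|(2 * s)^-1| = (2 * s)^-1 by rewrite ger0_norm// invr_ge0 mulr_ge0// ltW.
have r0 : 0 <= Rcoef_ratio ^+ l.+1 by rewrite exprn_ge0// ltW// Rcoef_ratio_gt0.
have b1 : `|(a + s) ^+ l.+1| <= Rcoef_ratio ^+ l.+1 by rewrite ger0_norm.
have b2 : `|(a - s) ^+ l.+1| <= Rcoef_ratio ^+ l.+1.
  rewrite normrX; apply: lerXn2r; rewrite ?nnegrE ?normr_ge0//; first exact/ltW/Rcoef_ratio_gt0.
  by rewrite /Rcoef_ratio ler_norml; apply/andP; split; have := a0; have := s0; lra.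
have -> : Rcoef_ratio / s * Rcoef_ratio ^+ l = (Rcoef_ratio ^+ l.+1 + Rcoef_ratio ^+ l.+1)
  * (2 * s)^-1.
  by rewrite exprS; field; rewrite gt_eqF.
apply: ler_wpM2r; first by rewrite invr_ge0 mulr_ge0// ltW.
by rewrite (le_trans (ler_normB _ _))// lerD.
Qed.

(** The partial sums of the inverse power series, multiplied by 1 + 2 a X - a X^2,
telescope to 1 up to two boundary terms, by the recurrence [RcoefSS]. *)
Lemma Rpartial_Tf f n : Rpartial a (Tf f) n.+1 =
  f - ((Rcoef a n.+1)%:C *: dil n.+1 f + (a * Rcoef a n)%:C *: dil n.+2 f).
Proof.
have dT m : dil m (Tf f) = - a%:C *: dil m.+2 f + ((2 * a)%:C *: dil m.+1 f + dil m f).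
  by rewrite /Tf dil_lin dil_lin !dil_dil addn2 addn1.
elim: n => [|n IH]; rewrite RpartialS dT.
  rewrite (_ : Rpartial a (Tf f) 0 = 0); last by apply/funext => t; rewrite /Rpartial big_ord0.
  rewrite Rcoef0 Rcoef1 dil0; apply/funext => t.
  by rewrite !fctE /GRing.scale /= !rmorphM rmorphN rmorph_nat rmorph1; ring.
rewrite IH RcoefSS; apply/funext => t.
by rewrite !fctE /GRing.scale /= rmorphD !rmorphM rmorphN rmorph_nat; ring.
Qed.

Lemma Rcoef_cvg0 : Rcoef a l @[l --> \oo] --> (0 : R).
Proof.
apply/norm_cvg0P.
apply: (@squeeze_cvgr _ _ _ _ (cst 0) (fun l => Rcoef_ratio / s * Rcoef_ratio ^+ l)).
- by apply: nearW => l; rewrite normr_ge0 Rcoef_le.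
- exact: cvg_cst.
- rewrite -[X in _ --> X](mulr0 (Rcoef_ratio / s)); apply: cvgM; first exact: cvg_cst.
  apply: cvg_expr; rewrite ger0_norm ?Rcoef_ratio_lt1// ltW// Rcoef_ratio_gt0//.
Qed.

Lemma Rpartial_Tf_cvg f : f \in @square_integrable R ->
  (fun n => sqnorm (Rpartial a (Tf f) n - f)) @ \oo --> 0%E.
Proof.
move=> sf; rewrite -cvg_shiftS.
(* v n * |f|^2 bounds the square norm of the two boundary terms of [Rpartial_Tf] *)
pose v n : R := 2 * Rcoef a n.+1 ^+ 2 + 2 * (a * Rcoef a n) ^+ 2.
apply: (@sqnorm_cvg0_le _ (fun n => (v n)%:E) (fine (sqnorm f))) => [n|n|];
  first exact: sqnorm_ge0.
  rewrite /= Rpartial_Tf addrC addKr sqnormN.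
  have m1 := sqi_measurable (sqi_dil n.+1 sf); have m2 := sqi_measurable (sqi_dil n.+2 sf).
  apply: (le_trans (sqnorm_ZD _ m1 (measurable_cfunZ _ m2))).
  rewrite sqnormZ// !normc2_real !sqnorm_dil//.
  have F : sqnorm f \is a fin_num by rewrite ge0_fin_numE//; exact: sqi_fin.
  by rewrite -(fineK F) -!EFinM -EFinD lee_fin /v; lra.
apply: cvg_EFin; first exact: nearW.
have c0 := Rcoef_cvg0.
have c1 : Rcoef a n.+1 @[n --> \oo] --> (0 : R) by rewrite (cvg_shiftS (Rcoef a)).
have -> : (0 : R) = 2 * (0 * 0) + 2 * ((a * 0) * (a * 0)) by ring.
rewrite /comp /=; under eq_fun do rewrite /v !expr2.
by apply: cvgD; apply: cvgM; (try exact: cvg_cst); apply: cvgM => //;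
  apply: cvgM => //; exact: cvg_cst.
Qed.

(** T is bounded, so it may be applied termwise to the limit of the partial sums; it
commutes with them, and [Rpartial_Tf_cvg] identifies the limit. *)
Lemma Tf_surj g : g \in @square_integrable R ->
  exists f, f \in @square_integrable R /\ sqnorm (Tf f - g) = 0%E.
Proof.
move=> sg.
have C0 : 0 < Rcoef_ratio / s by rewrite divr_gt0// Rcoef_ratio_gt0.
have F : sqnorm g \is a fin_num by rewrite ge0_fin_numE//; exact: sqi_fin.
have [z [sz]] := geometric_series_sqnorm_cvg C0 Rcoef_ratio_gt0 Rcoef_ratio_lt1
  (fine_ge0 (sqnorm_ge0 g)) Rcoef_le (fun l => sqi_dil l sg)
  (fun l => ltac:(by rewrite sqnorm_dil// fineK)).
under eq_cvg do rewrite -Rpartial_dil.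
move=> cv; exists z; split => //.
apply: (@sqnorm_cvg_uniq (fun n => Tf (Rpartial a g n))).
- by move=> n; apply: sqi_measurable; apply: sqi_Tf; exact: sqi_Rpartial.
- by apply: sqi_measurable; exact: sqi_Tf.
- exact: sqi_measurable.
- apply: sqnorm_cvg0_le cv => n; first exact: sqnorm_ge0.
  rewrite (_ : Tf _ - Tf z = Tf (Rpartial a g n - z));
    first exact: sqnorm_Tf (sqiB (sqi_Rpartial n sg) sz).
  by rewrite addrC -scaleN1r -Tf_lin scaleN1r addrC.
- by under eq_cvg do rewrite Tf_Rpartial; exact: Rpartial_Tf_cvg.
Qed.

(** The partial sums at T f converge to f in L^2; passing from T f to the representative
chosen by [L2_fun] changes each of them on a null set only, and limits in L^2 are
unique. *)
Lemma Rop_Tf_pos f y z : is_class z f -> is_class y (Tf f) -> Rop a y = z.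
Proof.
move=> [sf zf] [sTf yf]; rewrite /Rop gt_eqF//.
have sy := L2_funP y; have sz := L2_funP z.
have my := sqi_measurable sy; have mz := sqi_measurable sz; have mf := sqi_measurable sf.
have mR h n : h \in @square_integrable R -> measurable_cfun (Rpartial a h n).
  by move=> sh; apply: sqi_measurable; exact: sqi_Rpartial.
have cv : (fun n => sqnorm (Rpartial a (L2_fun y) n - L2_fun z)) @ \oo --> 0%E.
  apply: cvg_trans (Rpartial_Tf_cvg sf); apply: near_eq_cvg; apply: nearW => n.
  rewrite -(@sqnorm_congr _ (L2_fun z) f)//; last exact: mR.
  rewrite sqnormBC (sqnormBC _ (L2_fun z)); apply/esym/sqnorm_congr => //; try exact: mR.
  rewrite (_ : _ - _ = Rpartial a (L2_fun y - Tf f) n); last first.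
    by rewrite addrC -scaleN1r -Rpartial_lin scaleN1r addrC.
  by apply: sqnorm_Rpartial0 => //; exact: sqiB.
apply: xget_unique; first exact: cv.
move=> z1 cv1; apply/(is_class_eq (is_class_fun z1) (is_class_fun z)).
apply: (sqnorm_cvg_uniq _ _ _ cv1 cv) => //; first by move=> n; exact: mR.
by apply: sqi_measurable; exact: L2_funP.
Qed.

End NeumannSeries.

Section InverseOperator.
Variables (R : realType) (a : R).
Hypotheses (a_ge0 : 0 <= a) (a_lt : a < 3^-1).

Lemma Tf0 (f : R -> R[i]) : Tf 0 f = f.
Proof. by rewrite /Tf mulr0 rmorph0 oppr0 !scale0r !add0r. Qed.

Lemma Rop_Tf (f : R -> R[i]) y z : is_class z f -> is_class y (Tf a f) -> Rop a y = z.
Proof.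
have [a0|a0] := eqVneq a 0; last by apply: Rop_Tf_pos => //; rewrite lt_neqAle eq_sym a0.
rewrite a0 Tf0 /Rop eqxx => zf yf; exact: is_class_uniq yf zf.
Qed.

Lemma Rop_ex y : exists f, is_class (Rop a y) f /\ is_class y (Tf a f).
Proof.
have sy := L2_funP y.
have [f [sf Hf]] : exists f, f \in @square_integrable R /\ sqnorm (Tf a f - L2_fun y) = 0%E.
  have [a0|a0] := eqVneq a 0; last by apply: Tf_surj => //; rewrite lt_neqAle eq_sym a0.
  by exists (L2_fun y); split => //; rewrite a0 Tf0 subrr sqnorm0.
have yf : is_class y (Tf a f) by split; [exact: sqi_Tf|rewrite sqnormBC].
have [z zf] := is_class_ex sf.
by exists f; split => //; rewrite (Rop_Tf zf yf).
Qed.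

Lemma Rop_linear (k : R[i]) y y' : Rop a (k *: y + y') = k *: Rop a y + Rop a y'.
Proof.
have [f [zf yf]] := Rop_ex y; have [f' [zf' yf']] := Rop_ex y'.
apply: (Rop_Tf (is_class_lin k zf zf')).
by rewrite Tf_lin; exact: is_class_lin.
Qed.

Lemma Rop_inj y : Rop a y = 0 -> y = 0.
Proof.
have [f [zf yf]] := Rop_ex y => y0; rewrite y0 in zf.
have f0 : sqnorm f = 0%E.
  by have := (is_class_eq zf (is_class0 R)).1 erefl; rewrite subr0.
apply/(is_class_eq yf (is_class0 R)); rewrite subr0.
apply/eqP; rewrite eq_le sqnorm_ge0 andbT.
by have [sf _] := zf; rewrite (le_trans (sqnorm_Tf a sf))// f0 mule0.
Qed.

End InverseOperator.

(** * The inner product and the exponentials *)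

Section InnerProduct.
Variable R : realType.
Local Notation mu := (@lebesgue_measure R).
Local Notation mR := (measurableTypeR R).
Implicit Types (f g h F G : R -> R[i]) (k : R[i]) (y z : L2 R).

Definition period_integrable F :=
  mu.-integrable (@period R) (EFin \o (fun t => complex.Re (F t))) /\
  mu.-integrable (@period R) (EFin \o (fun t => complex.Im (F t))).

Local Notation cint := (cintegral (@period R)).

Lemma cintegral_lin k F G : period_integrable F -> period_integrable G ->
  cint (fun t => k * F t + G t) = k * cint F + cint G.
Proof.
case: k => u v [Fr Fi] [Gr Gi].
have Z (w : R) (h : R -> R) : mu.-integrable (@period R) (EFin \o h) ->
    mu.-integrable (@period R) (EFin \o (fun t => w * h t)).
  move=> ih; rewrite (_ : EFin \o _ = fun t => (w%:E * (EFin \o h) t)%E).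
    exact: (integrableZl (@measurable_period R)).
  by apply/funext => t; rewrite /= EFinM.
have D (h1 h2 : R -> R) : mu.-integrable (@period R) (EFin \o h1) ->
    mu.-integrable (@period R) (EFin \o h2) ->
    mu.-integrable (@period R) (EFin \o (fun t => h1 t + h2 t)).
  move=> i1 i2; rewrite (_ : EFin \o _ = ((EFin \o h1) \+ (EFin \o h2))%E).
    exact: (integrableD (@measurable_period R)).
  by apply/funext => t; rewrite /= EFinD.
have lin3 (b c : R) (h1 h2 h3 : R -> R) : mu.-integrable (@period R) (EFin \o h1) ->
    mu.-integrable (@period R) (EFin \o h2) -> mu.-integrable (@period R) (EFin \o h3) ->
    \int[mu]_(t in @period R) (b * h1 t + c * h2 t + h3 t) =
    b * (\int[mu]_(t in @period R) h1 t) + c * (\int[mu]_(t in @period R) h2 t) +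
    \int[mu]_(t in @period R) h3 t.
  move=> i1 i2 i3; have mp := @measurable_period R.
  rewrite (RintegralD mp (D _ _ (Z b _ i1) (Z c _ i2)) i3).
  by rewrite (RintegralD mp (Z b _ i1) (Z c _ i2)) (RintegralZl _ mp i1) (RintegralZl _ mp i2).
rewrite /cintegral.
have -> : (\int[mu]_(t in @period R) complex.Re ((u +i* v) * F t + G t)) =
   u * (\int[mu]_(t in @period R) complex.Re (F t)) +
   (- v) * (\int[mu]_(t in @period R) complex.Im (F t)) +
   (\int[mu]_(t in @period R) complex.Re (G t)).
  rewrite -lin3//.
  by apply: eq_Rintegral => t _; case: (F t) (G t) => [? ?] [? ?] /=; rewrite mulNr.
have -> : (\int[mu]_(t in @period R) complex.Im ((u +i* v) * F t + G t)) =
   u * (\int[mu]_(t in @period R) complex.Im (F t)) +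
   v * (\int[mu]_(t in @period R) complex.Re (F t)) +
   (\int[mu]_(t in @period R) complex.Im (G t)).
  rewrite -lin3//.
  by apply: eq_Rintegral => t _; case: (F t) (G t) => [? ?] [? ?].
by apply/eqP; rewrite eq_complex /= mulNr !eqxx.
Qed.

Lemma cintegral_conj F : period_integrable F -> cint (fun t => (F t)^*) = (cint F)^*.
Proof.
move=> [_ iF]; rewrite /cintegral; apply/eqP; rewrite eq_complex /=.
apply/andP; split; apply/eqP.
  by apply: eq_Rintegral => t _; case: (F t).
rewrite -[RHS]mulN1r -RintegralZl//=.
by apply: eq_Rintegral => t _; case: (F t) => ? ? /=; rewrite mulN1r.
Qed.

Lemma measurable_mul_conj f g : measurable_cfun f -> measurable_cfun g ->
  measurable_cfun (fun t => f t * (g t)^*).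
Proof.
move=> [fr fi] [gr gi]; split.
- rewrite (_ : _ \o _ = fun t => complex.Re (f t) * complex.Re (g t) + complex.Im (f t)
    * complex.Im (g t)).
    by apply: measurable_funD; apply: measurable_funM.
  by apply/funext => t /=; case: (f t) (g t) => [? ?] [? ?] /=; rewrite mulrN opprK.
- rewrite (_ : _ \o _ = fun t => complex.Im (f t) * complex.Re (g t) - complex.Re (f t)
    * complex.Im (g t)).
    by apply: measurable_funB; apply: measurable_funM.
  by apply/funext => t /=; case: (f t) (g t) => [? ?] [? ?] /=; ring.
Qed.

(** From |f g| <= |f|^2 + |g|^2. *)
Lemma integrable_mul_conj f g : f \in @square_integrable R -> g \in @square_integrable R ->
  period_integrable (fun t => f t * (g t)^*).
Proof.
move=> sf sg; have mf := sqi_measurable sf; have mg := sqi_measurable sg.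
have [mr mi] := measurable_mul_conj mf mg.
have isq h : h \in @square_integrable R ->
    mu.-integrable (@period R) (fun t => (Normc.normc (h t) ^+ 2)%:E).
  move=> sh; apply/integrableP; split.
    by apply: measurable_EFin_normc2; exact: sqi_measurable.
  under eq_integral do rewrite gee0_abs ?lee_fin ?sqr_ge0//.
  exact: sqi_fin.
have dom := integrableD (@measurable_period R) (isq _ sf) (isq _ sg).
have bnd (h : R -> R) : measurable_fun setT (h : mR -> mR) ->
    (forall t, `|h t| <= Normc.normc (f t) ^+ 2 + Normc.normc (g t) ^+ 2) ->
    mu.-integrable (@period R) (EFin \o h).
  move=> mh hfg; apply: (le_integrable (@measurable_period R) _ _ dom).
    by apply/measurable_EFinP; exact: measurable_funTS.
  move=> t _; rewrite /= lee_fin; apply: (le_trans (hfg t)).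
  by rewrite ger0_norm// addr_ge0// sqr_ge0.
have N t : Normc.normc (f t * (g t)^*) <= Normc.normc (f t) ^+ 2 + Normc.normc (g t) ^+ 2.
  have -> : Normc.normc (f t * (g t)^*) = Normc.normc (f t) * Normc.normc (g t).
    by rewrite Normc.normcM; congr (_ * _); case: (g t) => ? ? /=; rewrite sqrrN.
  have := normc_ge0 (f t); have := normc_ge0 (g t); rewrite !expr2; nra.
split; apply: bnd => // t.
- exact: le_trans (normr_Re_le _) (N t).
- exact: le_trans (normr_Im_le _) (N t).
Qed.

Lemma ae_eq_cintegral F G : measurable_cfun F -> measurable_cfun G ->
  ae_eq mu (@period R) F G -> cint F = cint G.
Proof.
move=> [Fr Fi] [Gr Gi] FG; rewrite /cintegral; congr (_ +i* _); congr fine;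
  apply: ae_eq_integral => //.
- by apply/measurable_EFinP; exact: measurable_funTS.
- by apply/measurable_EFinP; exact: measurable_funTS.
- by move: FG; apply: lebesgue_aeS => t FG pt /=; rewrite FG.
- by apply/measurable_EFinP; exact: measurable_funTS.
- by apply/measurable_EFinP; exact: measurable_funTS.
- by move: FG; apply: lebesgue_aeS => t FG pt /=; rewrite FG.
Qed.

Definition fun_ip f g : R[i] := (2 * pi)^-1%:C * cint (fun t => f t * (g t)^*).

Lemma L2_ip_class y z f g : is_class y f -> is_class z g -> L2_ip y z = fun_ip f g.
Proof.
move=> [sf yf] [sg zg]; congr (_ * _).
have my := sqi_measurable (L2_funP y); have mz := sqi_measurable (L2_funP z).
have mf := sqi_measurable sf; have mg := sqi_measurable sg.
apply: ae_eq_cintegral; try exact: measurable_mul_conj.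
have := (sqnorm_eq0P (measurable_cfunB my mf)).1 yf.
have := (sqnorm_eq0P (measurable_cfunB mz mg)).1 zg.
apply: (@filterS2 _ _ (ae_filter_ringOfSetsType mu)) => t H1 H2 pt.
move: (H1 pt) (H2 pt); rewrite !fctE => /eqP; rewrite subr_eq0 => /eqP ->.
by move/eqP; rewrite subr_eq0 => /eqP ->.
Qed.

Lemma fun_ip_lin k f f' g : f \in @square_integrable R -> f' \in @square_integrable R ->
  g \in @square_integrable R -> fun_ip (k *: f + f') g = k * fun_ip f g + fun_ip f' g.
Proof.
move=> sf sf' sg; rewrite /fun_ip mulrCA -mulrDr; congr (_ * _).
rewrite -cintegral_lin; try exact: integrable_mul_conj.
congr cintegral; apply/funext => t.
by rewrite !fctE /GRing.scale /= mulrDl mulrA.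
Qed.

Lemma fun_ip_conj f g : f \in @square_integrable R -> g \in @square_integrable R ->
  fun_ip f g = (fun_ip g f)^*.
Proof.
move=> sf sg; rewrite /fun_ip [RHS]rmorphM -[RHS]/(Num.conj _ * Num.conj _).
rewrite -[Num.conj (cintegral _ _)](cintegral_conj (integrable_mul_conj sg sf)).
congr (_ * _); first by rewrite -[RHS]/(conjc _) conjc_real.
congr cintegral; apply/funext => t.
by rewrite [RHS]rmorphM -[RHS]/(Num.conj _ * Num.conj _) conjCK mulrC.
Qed.

Lemma fun_ip_self f : f \in @square_integrable R ->
  fun_ip f f = ((2 * pi)^-1 * fine (sqnorm f))%:C.
Proof.
move=> sf; rewrite /fun_ip rmorphM; congr (_ * _).
have E t : f t * (f t)^* = (Normc.normc (f t) ^+ 2)%:C.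
  rewrite normc2E; case: (f t) => x y; apply/eqP; rewrite eq_complex /=.
  by apply/andP; split; apply/eqP; ring.
rewrite /cintegral; apply/eqP; rewrite eq_complex /=; apply/andP; split; apply/eqP.
  by congr fine; apply: eq_integral => t _; rewrite E.
rewrite -[RHS](mul0r (fine (mu (@period R)))) -Rintegral_cst//.
by apply: eq_Rintegral => t _; rewrite E.
Qed.

Lemma Rintegral_period_derive (f F : R -> R) : continuous f ->
  (forall t : R, is_derive t 1 F (f t)) -> \int[mu]_(t in @period R) f t = F (2 * pi) - F 0.
Proof.
move=> cf dF.
have cF : continuous F.
  by move=> t; apply: differentiable_continuous; apply/derivable1_diffP; exact: ex_derive.
rewrite /Rintegral /period (@continuous_FTC2 _ f F)//.
- by rewrite mulr_gt0// pi_gt0.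
- exact: continuous_subspaceT.
- split.
  + by move=> t _; exact: ex_derive.
  + by apply: cvg_at_right_filter; exact: cF.
  + by apply: cvg_at_left_filter; exact: cF.
- by move=> t _; rewrite derive1E derive_val.
Qed.

Lemma cos_2pi_int (m : int) : cos (m%:~R * (2 * pi)) = 1 :> R.
Proof.
have := @periodic_shift R cos m 0; rewrite add0r cos0; apply.
by move=> x; rewrite mulr_natl cosD2pi.
Qed.

Lemma sin_2pi_int (m : int) : sin (m%:~R * (2 * pi)) = 0 :> R.
Proof.
have := @periodic_shift R sin m 0; rewrite add0r sin0; apply.
by move=> x; rewrite mulr_natl sinD2pi.
Qed.

(** For m <> 0 the functions cos (m t) and sin (m t) have the periodic primitives
sin (m t) / m and - cos (m t) / m. *)
Lemma cintegral_cexp (m : int) : m != 0 -> cint (fun t => cexp (m%:~R * t)) = 0.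
Proof.
move=> m0; have mR0 : (m%:~R : R) != 0 by rewrite intr_eq0.
have cM : continuous (fun x : R => m%:~R * x).
  by move=> x; apply: cvgM; [exact: cvg_cst|exact: cvg_id].
have dZ (k : R) (F : R -> R) (t d : R) : is_derive t 1 F d ->
    is_derive t 1 (fun x => k * F x) (k * d).
  by move=> dF; apply: is_deriveZ.
have dM (t : R) : is_derive t 1 (fun x : R => m%:~R * x) (m%:~R).
  by rewrite -[X in is_derive _ _ _ X]mulr1; exact: dZ.
rewrite /cintegral /=.
have cM' (h : R -> R) : continuous h -> continuous (fun x : R => h (m%:~R * x)).
  by move=> ch t; apply: continuous_comp; [exact: cM|exact: ch].
have dS (t : R) : is_derive t 1 (fun x => m%:~R^-1 * sin (m%:~R * x)) (cos (m%:~R * t)).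
  have d := is_derive1_comp (is_derive_sin (m%:~R * t)) (dM t).
  by have := dZ m%:~R^-1 _ _ _ d; rewrite mulrC mulfK.
have dC (t : R) : is_derive t 1 (fun x => - m%:~R^-1 * cos (m%:~R * x)) (sin (m%:~R * t)).
  have d := is_derive1_comp (is_derive_cos (m%:~R * t)) (dM t).
  by have := dZ (- m%:~R^-1) _ _ _ d; rewrite mulNr mulNr mulrN opprK mulrC mulfK.
rewrite (Rintegral_period_derive (cM' _ (@continuous_cos R)) dS).
rewrite (Rintegral_period_derive (cM' _ (@continuous_sin R)) dC).
have Z0 : (m%:~R : R) * 0 = 0 by rewrite mulr0.
by rewrite cos_2pi_int sin_2pi_int Z0 sin0 cos0 !subrr.
Qed.

Lemma fun_ip_gammak0 (i j : int) : fun_ip (gammak 0 i) (gammak 0 j) = (i == j)%:R :> R[i].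
Proof.
have E t : gammak 0 i t * (gammak 0 j t)^* = cexp ((i - j)%:~R * t) :> R[i].
  rewrite !gammak0E rmorphB mulrDl cexpD mulNr; congr (_ * _).
  by rewrite /cexp cosN sinN.
rewrite /fun_ip; under [X in cint X]eq_fun do rewrite E.
have [->|ij] := eqVneq i j; last by rewrite cintegral_cexp ?mulr0// subr_eq0.
have pi0 : 0 < (pi : R) := pi_gt0 R.
have -> : cint (fun t => cexp ((j - j)%:~R * t)) = (2 * pi)%:C :> R[i].
  rewrite /cintegral subrr; apply/eqP; rewrite eq_complex /=.
  have mp : fine (mu (@period R)) = 2 * pi.
    by rewrite /period /= lebesgue_measure_itv /= lte_fin mulr_gt0//= oppr0 addr0.
  apply/andP; split; apply/eqP.
    rewrite -[RHS]mul1r -mp -Rintegral_cst//.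
    by apply: eq_Rintegral => t _; rewrite mul0r cos0.
  rewrite -[RHS](mul0r (fine (mu (@period R)))) -Rintegral_cst//.
  by apply: eq_Rintegral => t _; rewrite mul0r sin0.
by rewrite -rmorphM mulVf// mulf_neq0// gt_eqF.
Qed.

Lemma L2_ip_linl z k y y' : L2_ip (k *: y + y') z = k * L2_ip y z + L2_ip y' z.
Proof.
have C := is_class_fun; apply: etrans (L2_ip_class (is_class_lin k (C R y) (C R y')) (C R z)) _.
exact: (fun_ip_lin k (L2_funP _) (L2_funP _) (L2_funP _)).
Qed.

Lemma L2_ip_conj y z : L2_ip y z = Num.conj (L2_ip z y).
Proof. exact: (fun_ip_conj (L2_funP _) (L2_funP _)). Qed.

Lemma L2_ip_linr z k y y' : L2_ip z (k *: y + y') = Num.conj k * L2_ip z y + L2_ip z y'.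
Proof.
rewrite (L2_ip_conj z (k *: y + y')) (L2_ip_linl z k y y').
rewrite (L2_ip_conj z y) (L2_ip_conj z y').
rewrite [LHS](rmorphD (@Num.conj R[i])).
by congr (_ + _); rewrite [LHS](rmorphM (@Num.conj R[i])).
Qed.

Lemma L2_ip_self y f : is_class y f -> L2_ip y y = ((2 * pi)^-1 * fine (sqnorm f))%:C.
Proof.
move=> yf; apply: etrans (L2_ip_class yf yf) _.
by have [sf _] := yf; exact: fun_ip_self.
Qed.

Lemma L2_ip_gt0 y : y != 0 -> 0 < L2_ip y y.
Proof.
move=> y0; have Cy := is_class_fun y; rewrite (L2_ip_self Cy) ltcR.
rewrite mulr_gt0 ?invr_gt0 ?mulr_gt0 ?pi_gt0// fine_gt0// sqi_fin ?L2_funP// andbT.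
rewrite lt_neqAle sqnorm_ge0 andbT; apply: contraNneq y0 => n0.
by apply/eqP/(is_class_eq Cy (is_class0 R)); rewrite subr0 -n0.
Qed.

End InnerProduct.

(** * The pulled back inner product and the Hilbert basis *)

Section RopInnerProduct.
Variables (R : realType) (a : R).
Hypotheses (a_ge0 : 0 <= a) (a_lt : a < 3^-1).
Implicit Types (f g : R -> R[i]) (k : R[i]) (y z : L2 R).

Lemma Rop_ip_linl z k y y' : Rop_ip a (k *: y + y') z = k * Rop_ip a y z + Rop_ip a y' z.
Proof. by rewrite /Rop_ip Rop_linear//; exact: L2_ip_linl. Qed.

Lemma Rop_ip_linr z k y y' :
  Rop_ip a z (k *: y + y') = Num.conj k * Rop_ip a z y + Rop_ip a z y'.
Proof. by rewrite /Rop_ip Rop_linear//; exact: L2_ip_linr. Qed.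

Lemma Rop_ip_herm y z : Rop_ip a y z = (-1) ^+ false * Num.conj (Rop_ip a z y).
Proof. by rewrite mul1r; exact: L2_ip_conj. Qed.

Lemma Rop_ip_gt0 y : y != 0 -> 0 < Rop_ip a y y.
Proof. by move=> y0; apply: L2_ip_gt0; apply: contra_neq y0; exact: Rop_inj. Qed.

(** The pullback of an inner product under the injective linear map R. *)
Definition Rop_dot : {dot (L2 R) for Num.conj} :=
  HB.pack (Rop_ip a)
    (@isBilinear.Build R[i] (L2 R) (L2 R) R[i] *%R (Num.conj \; *%R) (Rop_ip a)
      (fun z => zmod_morphism_linear
        (Rop_ip_linl z : GRing.linear_for *%R ((Rop_ip a)^~ z)))
      (fun z => zmod_morphism_linear
        (Rop_ip_linr z : GRing.linear_for (Num.conj \; *%R) (Rop_ip a z)))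
      (fun z => scalable_linear
        (Rop_ip_linl z : GRing.linear_for *%R ((Rop_ip a)^~ z)))
      (fun z => scalable_linear
        (Rop_ip_linr z : GRing.linear_for (Num.conj \; *%R) (Rop_ip a z))))
    (@isHermitianSesquilinear.Build R[i] (L2 R) false Num.conj (Rop_ip a) Rop_ip_herm)
    (@isDotProduct.Build R[i] (L2 R) (Rop_ip a) Rop_ip_gt0).

(** With w the argument of gamma, this is Euler's identity
a cos (3 w) - 3 I a sin (3 w) = 2 a exp (- 3 I w) - a exp (3 I w), where I^2 = -1. *)
Lemma gammak_Tf i : gammak a i = Tf a (gammak 0 i).
Proof.
apply/funext => t; rewrite TfE !gammak0E /gammak /gamma.
set w := i%:~R * t.
have -> : i%:~R * (-2 * t) = w + - (3 * w) by rewrite /w; ring.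
have -> : i%:~R * (4 * t) = w + 3 * w by rewrite /w; ring.
have three : 3 = 3%:R%:C :> R[i] by rewrite rmorph_nat.
have two : 2 = 2%:R%:C :> R[i] by rewrite rmorph_nat.
rewrite !cexpD /cexp cosN sinN three two; apply/eqP; rewrite eq_complex /=.
by apply/andP; split; apply/eqP; ring.
Qed.

Lemma Rop_gamma i : Rop a (L2_gamma a i) = L2_gamma 0 i.
Proof.
apply: (Rop_Tf a_ge0 a_lt (is_class_of (gammak_square_integrable 0 i))).
by rewrite -gammak_Tf; exact: is_class_of.
Qed.

Lemma gamma_orthonormal : orthonormal_family Rop_dot (L2_gamma a : int -> L2 R).
Proof.
move=> i j; rewrite -[LHS]/(L2_ip (Rop a (L2_gamma a i)) (Rop a (L2_gamma a j))).
rewrite !Rop_gamma; apply: etrans (fun_ip_gammak0 R i j).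
by apply: L2_ip_class; exact: is_class_of.
Qed.

(** Merges the repeated frequencies of a list of pairs, since [dense_span] asks for a
coefficient function of the frequency. *)
Lemma regroup_sum (V : lmodType R[i]) (e : int -> V) (l : seq (R[i] * int)) :
  \sum_(k <- undup (map snd l)) (\sum_(x <- l | x.2 == k) x.1) *: e k =
  \sum_(x <- l) x.1 *: e x.2.
Proof.
under eq_bigr do rewrite scaler_suml big_mkcond.
rewrite exchange_big /= [LHS]big_seq [RHS]big_seq; apply: eq_bigr => x xl.
rewrite (bigD1_seq x.2) ?undup_uniq ?mem_undup ?map_f//= eqxx.
by rewrite big1 ?addr0// => k; rewrite eq_sym => /negbTE ->.
Qed.

Lemma Rop_sum (l : seq (R[i] * int)) :
  Rop a (\sum_(x <- l) x.1 *: L2_gamma a x.2) = \sum_(x <- l) x.1 *: L2_gamma 0 x.2.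
Proof.
elim: l => [|x l IH]; last by rewrite !big_cons Rop_linear// IH Rop_gamma.
by have := Rop_linear a_ge0 a_lt (-1) 0 0; rewrite !big_nil !scaleN1r !addNr.
Qed.

(** R turns the distance from v to a combination of the gamma_k into the distance from
R v to the same combination of the e_k, so [trigpoly_dense] at R v suffices. *)
Lemma gamma_dense : dense_span Rop_dot (L2_gamma a : int -> L2 R).
Proof.
move=> v eps eps0.
have [e e0 epsE] : exists2 e : R, 0 < e & eps = e%:C.
  by move: eps eps0 => [e e'] /andP[/eqP /= -> e0]; exists e.
have [f [vf _]] := Rop_ex a_ge0 a_lt v.
have [sf _] := vf.
have pi0 : 0 < (pi : R) := pi_gt0 R.
have d0 : 0 < 2 * pi * e ^+ 2 by rewrite !mulr_gt0// exprn_gt0.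
have [p [[l ->] fp]] := trigpoly_dense (sqi_measurable sf) (sqi_fin sf) d0.
exists (undup (map snd l)), (fun k : int => \sum_(x <- l | x.2 == k) x.1).
rewrite regroup_sum; set w := v - _.
have wE : is_class (Rop a w) (f - \sum_(x <- l) x.1 *: gammak 0 x.2).
  have -> : w = (-1 : R[i]) *: (\sum_(x <- l) x.1 *: L2_gamma a x.2) + v.
    by rewrite scaleN1r addrC.
  have -> : f - \sum_(x <- l) x.1 *: gammak 0 x.2 =
      (-1 : R[i]) *: (\sum_(x <- l) x.1 *: gammak 0 x.2) + f.
    by rewrite scaleN1r addrC.
  rewrite Rop_linear// Rop_sum.
  apply: is_class_lin vf; apply: is_class_sum => x.
  exact: is_class_of.
change (sqrtC (L2_ip (Rop a w) (Rop a w)) < eps); rewrite (L2_ip_self wE) epsE.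
set N := fine _.
have N0 : 0 <= N by exact: fine_ge0.
have Ne : N < 2 * pi * e ^+ 2.
  by rewrite -lte_fin fineK//; exact: sqnorm_fin_num fp.
have x0 : 0 <= ((2 * pi)^-1 * N)%:C :> R[i].
  by rewrite ler0c mulr_ge0// invr_ge0 mulr_ge0// ltW.
rewrite -(@ltr_pXn2r _ 2)// ?nnegrE ?sqrtC_ge0//; last by rewrite ler0c ltW.
rewrite sqrtCK -rmorphXn ltcR mulrC ltr_pdivrMr ?mulr_gt0//.
by rewrite mulrC.
Qed.

End RopInnerProduct.

Theorem proposition2p1 (R : realType) (a : R) (a_ge0 : 0 <= a) (a_lt : a < 3^-1) :
  exists ip : {dot (L2 R) for Num.conj},
    (forall f g : L2 R, ip f g = Rop_ip a f g) /\
    hilbert_basis ip (L2_gamma a : int -> L2 R).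
Proof.
exists (Rop_dot a_ge0 a_lt); split => //.
by split; [exact: gamma_orthonormal|exact: gamma_dense].
Qed.
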